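(* Let $G$ be an étale groupoid. If $G$ has the full uniqueness property, then $G$ is effective.
   Context: A groupoid $G$ has unit space $G^{(0)}\subset G$, source and range maps $s,r\colon G\to G^{(0)}$, and multiplication defined on $\{(\alpha,\beta): s(\alpha)=r(\beta)\}$. A topological groupoid is a groupoid with a topology making multiplication and inversion continuous. It is étale if $G^{(0)}$ is locally compact Hausdorff in the relative topology and $s\colon G\to G^{(0)}$ is a local homeomorphism. Étale groupoids are not assumed Hausdorff. Put $G_x=s^{-1}(x)$ and $\mathrm{Iso}(G)=\{\gamma: s(\gamma)=r(\gamma)\}$. For an open Hausdorff $U\subset G$, functions in $C_c(U)$ are extended by $0$ to $G$; $\mathcal C(G)$ is the linear span of $\bigcup_U C_c(U)$ over all open Hausdorff $U\subset G$. It is a $*$-algebra with $f*g(\gamma)=\sum_{\beta\in G_{s(\gamma)}}f(\gamma\beta^{-1})g(\beta)$ and $f^*(\gamma)=\overline{f(\gamma^{-1})}$. $C^*(G)$ is the completion of $\mathcal C(G)$ in the universal norm $\|f\|=\sup\{\|\rho(f)\| : \rho\colon\mathcal C(G)\to B(\mathcal{H})\text{ a }*\text{-representation on a Hilbert space } \mathcal{H}\}$ (a finite C*-norm). The inclusion $C_c(G^{(0)})\subset\mathcal C(G)$ (recall $G^{(0)}$ is open in $G$) extends to an inclusion $C_0(G^{(0)})\subset C^*(G)$. $G$ has the full uniqueness property if every non-zero (closed two-sided) ideal $I\subset C^*(G)$ satisfies $I\cap C_0(G^{(0)})\neq\{0\}$. $G$ is effective if $G^{(0)}=\mathrm{Iso}(G)^{\circ}$,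 the interior of $\mathrm{Iso}(G)$ in $G$. *)

(* Defs.v *)
From HB Require Import structures.
From mathcomp Require Import all_boot all_order all_algebra.
From mathcomp Require Import generic_quotient ring_quotient.
From mathcomp Require Import all_classical all_reals all_analysis.
From mathcomp Require Import complex ring lra.

Set Implicit Arguments.
Unset Strict Implicit.
Unset Printing Implicit Defensive.

Import Order.TTheory GRing.Theory Num.Theory numFieldNormedType.Exports.

Local Open Scope classical_set_scope.
Local Open Scope ring_scope.
Local Open Scope quotient_scope.

(* [gmul a b] is total for convenience; it is the product of [a] and [b] only
   when [src a = rng b], and is unspecified otherwise. *)
Record groupoid (G : Type) := Groupoid {
  units : set G;
  src : G -> units;
  rng : G -> units;
  gmul : G -> G -> G;
  ginv : G -> G;
  src_unit : forall x : units, src (\val x) = x;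
  rng_unit : forall x : units, rng (\val x) = x;
  src_gmul : forall a b, src a = rng b -> src (gmul a b) = src b;
  rng_gmul : forall a b, src a = rng b -> rng (gmul a b) = rng a;
  gmulA : forall a b c, src a = rng b -> src b = rng c ->
    gmul a (gmul b c) = gmul (gmul a b) c;
  gmul_unitl : forall a, gmul (\val (rng a)) a = a;
  gmul_unitr : forall a, gmul a (\val (src a)) = a;
  src_ginv : forall a, src (ginv a) = rng a;
  rng_ginv : forall a, rng (ginv a) = src a;
  gmulV : forall a, gmul a (ginv a) = \val (rng a);
  gmulVl : forall a, gmul (ginv a) a = \val (src a)
}.

Definition Iso (G : Type) (Gd : groupoid G) : set G :=
  [set a | src Gd a = rng Gd a].

Definition topological_groupoid (G : topologicalType) (Gd : groupoid G) : Prop :=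
  {within [set p : G * G | src Gd p.1 = rng Gd p.2],
    continuous (fun p : G * G => gmul Gd p.1 p.2)} /\
  continuous (ginv Gd).

Definition local_homeomorphism (X Y : topologicalType) (f : X -> Y) : Prop :=
  forall x, exists U : set X,
    [/\ open U, U x, open (f @` U), {within U, continuous f} &
      exists g : Y -> X,
        (forall z, U z -> g (f z) = z) /\ {within f @` U, continuous g}].

(* The type [units Gd] carries the topology induced from [G]. *)
Definition etale_groupoid (G : topologicalType) (Gd : groupoid G) : Prop :=
  [/\ topological_groupoid Gd,
      locally_compact [set: units Gd],
      hausdorff_space (units Gd) &
      local_homeomorphism (src Gd)].

Definition effective (G : topologicalType) (Gd : groupoid G) : Prop :=
  units Gd = (Iso Gd)°.

Definition dot_norm (R : realType) (H : lmodType R[i])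
    (dot : {dot H for (@Num.conj R[i])}) (x : H) : R :=
  Num.sqrt (complex.Re (dot x x)).

Record hilbert (R : realType) := Hilbert {
  hilbert_sort :> lmodType R[i];
  hdot : {dot hilbert_sort for (@Num.conj R[i])};
  hilbert_complete : forall u : nat -> hilbert_sort,
    (forall e : R, 0 < e -> exists N : nat, forall m n : nat,
      (N <= m)%N -> (N <= n)%N -> dot_norm hdot (u m - u n) < e) ->
    exists l : hilbert_sort, forall e : R, 0 < e -> exists N : nat,
      forall n : nat, (N <= n)%N -> dot_norm hdot (u n - l) < e
}.

Definition hnorm (R : realType) (H : hilbert R) (x : H) : R :=
  dot_norm (hdot H) x.

Definition bounded_operator (R : realType) (H : hilbert R) (T : H -> H) : Prop :=
  linear T /\ exists M : R, forall x, hnorm (T x) <= M * hnorm x.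

Definition opnorm (R : realType) (H : hilbert R) (T : H -> H) : \bar R :=
  ereal_sup [set (hnorm (T x))%:E | x in [set x : H | hnorm x <= 1]].

Section HilbertNorm.
Context (R : realType) (H : hilbert R).
Implicit Types x y : H.

Lemma hnorm_ge0 x : 0 <= hnorm x.
Proof. exact: sqrtr_ge0. Qed.

Lemma hdotxx x : hdot H x x = ((hnorm x) ^+ 2)%:C%C.
Proof.
have := dnorm_ge0 (hdot H) x; rewrite lecE /= => /andP[/eqP im0 re0].
rewrite /hnorm /dot_norm sqr_sqrtr //.
by move: im0 re0; case: (hdot H x x) => a b /= -> _.
Qed.

Lemma hnorm_eq0 x : (hnorm x == 0) = (x == 0).
Proof.
rewrite -(dnorm_eq0 (hdot H)) hdotxx.
by rewrite (_ : (0 : R[i]) = 0%:C%C) // (inj_eq (@complexI R)) expf_eq0.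
Qed.

Lemma hnorm_scale (c : R[i]) x : hnorm (c *: x) = complex.Re `|c| * hnorm x.
Proof.
rewrite /hnorm /dot_norm dnormZ hdotxx normc_def -!rmorphXn -rmorphM /=.
by rewrite sqrtrM ?sqr_ge0 // !sqrtr_sqr (ger0_norm (sqrtr_ge0 _))
  (ger0_norm (hnorm_ge0 _)).
Qed.

Lemma Re_hdot_le x y : complex.Re (hdot H x y) <= hnorm x * hnorm y.
Proof.
have [->|x0] := eqVneq x 0.
  by rewrite linear0l /= mulr_ge0 // hnorm_ge0.
have [->|y0] := eqVneq y 0.
  by rewrite linear0r /= mulr_ge0 // hnorm_ge0.
have gtx : 0 < hnorm x by rewrite lt_def hnorm_eq0 x0 hnorm_ge0.
have gty : 0 < hnorm y by rewrite lt_def hnorm_eq0 y0 hnorm_ge0.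
have := dnorm_ge0 (hdot H) ((hnorm y)%:C%C *: x - (hnorm x)%:C%C *: y).
rewrite dnormB !dnormZ !hdotxx linearZl_LR linearZr_LR /=.
set d := hdot H x y; rewrite !normc_def /=.
rewrite !expr0n /= !addr0 !sqrtr_sqr !ger0_norm ?hnorm_ge0 //.
rewrite lecE => /andP[_]; case: d => a b /=.
rewrite !(mul0r, mulr0, subr0, addr0, add0r, oppr0, expr2) /= => h.
have : 0 <= 2 * (hnorm x * hnorm y) * (hnorm x * hnorm y - a).
  by apply: le_trans h _; rewrite le_eqVlt; apply/orP; left; apply/eqP; ring.
by rewrite pmulr_rge0 ?subr_ge0 // !mulr_gt0.
Qed.

Lemma hnorm_add x y : hnorm (x + y) <= hnorm x + hnorm y.
Proof.
rewrite -(@ler_pXn2r _ 2) ?nnegrE ?addr_ge0 ?hnorm_ge0 //.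
have -> : hnorm (x + y) ^+ 2 = hnorm x ^+ 2 + hnorm y ^+ 2 +
    2 * complex.Re (hdot H x y).
  have := dnormD (hdot H) x y; rewrite !hdotxx /= => /(congr1 (@complex.Re R)).
  by case: (hdot H x y) => a b /= ->; ring.
by have := Re_hdot_le x y; nra.
Qed.

End HilbertNorm.

Section ConvolutionAlgebra.
Context (R : realType) (G : topologicalType) (Gd : groupoid G).

(* [R[i]^o] is [R[i]] with its usual topology. *)
Local Notation C := (R[i]^o).

(* For [U] Hausdorff and open: functions on [U], extended by 0, continuous on
   [U], the support being the closure relative to [U]. *)
Definition Cc (U : set G) : set (G -> C) :=
  [set f | [/\ forall a, ~ U a -> f a = 0,
               {within U, continuous f} &
               compact (U `&` closure [set a | f a != 0])]].

Definition elementary : set (G -> C) :=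
  [set f | exists U : set G, [/\ open U, hausdorff_space U & Cc U f]].

Definition conv_algebra : set (G -> C) :=
  [set f | exists s : seq (C * (G -> C)),
    (forall p, p \in s -> elementary p.2) /\ f = \sum_(p <- s) p.1 *: p.2].

(* The sum is finitely supported for [f] and [g] in [conv_algebra]. *)
Definition conv (f g : G -> C) : G -> C := fun a =>
  \sum_(b \in [set b | src Gd b = src Gd a]) f (gmul Gd a (ginv Gd b)) * g b.

Definition star (f : G -> C) : G -> C := fun a => Num.conj (f (ginv Gd a)).

(* Only the values of [rho] on [conv_algebra] matter. *)
Definition star_representation (H : hilbert R) (rho : (G -> C) -> H -> H) :
    Prop :=
  [/\ forall f, conv_algebra f -> bounded_operator (rho f),
      forall (c : C) f g x, conv_algebra f -> conv_algebra g ->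
        rho (c *: f + g) x = c *: rho f x + rho g x,
      forall f g x, conv_algebra f -> conv_algebra g ->
        rho (conv f g) x = rho f (rho g x) &
      forall f x y, conv_algebra f ->
        hdot H (rho (star f) x) y = hdot H x (rho f y)].

Definition unorm (f : G -> C) : \bar R :=
  ereal_sup [set opr | exists (H : hilbert R) (rho : (G -> C) -> H -> H),
    star_representation rho /\ opr = opnorm (rho f)].

End ConvolutionAlgebra.

Section GroupoidCstar.
Context (R : realType) (G : topologicalType) (Gd : groupoid G).
Local Notation C := (R[i]^o).
Implicit Types f g : G -> C.

Lemma conv_algebra0 : conv_algebra (0 : G -> C).
Proof. by exists [::]; rewrite big_nil; split. Qed.

Lemma conv_algebraP (c : C) f g :
  conv_algebra f -> conv_algebra g -> conv_algebra (c *: f + g).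
Proof.
move=> [s [hs ->]] [t [ht ->]]; exists ([seq (c * p.1, p.2) | p <- s] ++ t).
split=> [p|].
  by rewrite mem_cat => /orP[/mapP[q /hs hq -> //]|/ht].
rewrite big_cat big_map scaler_sumr; congr (_ + _).
by apply: eq_bigr => p _; rewrite scalerA.
Qed.

Lemma conv_algebraB f g :
  conv_algebra f -> conv_algebra g -> conv_algebra (f - g).
Proof.
move=> hf hg; rewrite -[f - g]addrC -scaleN1r.
exact: conv_algebraP.
Qed.

Lemma unorm0 : (unorm Gd (0%R : (G -> C)%type) <= 0)%E.
Proof.
apply: ge_ereal_sup => _ [H [rho [[_ rhol _ _] ->]]].
apply: ge_ereal_sup => _ [x _ <-]; rewrite lee_fin.
have := rhol 1 0 0 x conv_algebra0 conv_algebra0.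
rewrite !scale1r addr0 -[LHS]addr0 => /addrI <-.
by have := hnorm_eq0 (0 : H); rewrite eqxx => /eqP ->.
Qed.

Lemma unorm_scale_add (c : C) f g : conv_algebra f -> conv_algebra g ->
  (unorm Gd (c *: f + g)%R <= (complex.Re `|c|)%:E * unorm Gd f + unorm Gd g)%E.
Proof.
have cge0 : 0 <= complex.Re `|c| by rewrite normc_def /= sqrtr_ge0.
move=> hf hg; apply: ge_ereal_sup => _ [H [rho [rhoR ->]]].
apply: ge_ereal_sup => _ [x x1 <-].
have [_ rhol _ _] := rhoR; rewrite rhol //.
have le_unorm h : ((hnorm (rho h x))%:E <= unorm Gd h)%E.
  apply: (@le_trans _ _ (opnorm (rho h))); apply: ereal_sup_ubound.
    by exists x.
  by exists H, rho.
apply: (@le_trans _ _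
    ((complex.Re `|c| * hnorm (rho f x))%:E + (hnorm (rho g x))%:E)%E).
  by rewrite -EFinD lee_fin -hnorm_scale hnorm_add.
by rewrite EFinM; apply: leeD => //; apply: lee_wpmul2l; rewrite ?lee_fin.
Qed.

Definition cauchy (u : nat -> G -> C) : Prop :=
  (forall n, conv_algebra (u n)) /\
  forall e : R, 0 < e -> exists N : nat, forall m n : nat,
    (N <= m)%N -> (N <= n)%N -> (unorm Gd (u m - u n)%R < e%:E)%E.

Definition null (u : nat -> G -> C) : Prop :=
  forall e : R, 0 < e -> exists N : nat, forall n : nat,
    (N <= n)%N -> (unorm Gd (u n) < e%:E)%E.

Definition cauchy_pred : {pred nat -> G -> C} := fun u => `[< cauchy u >].

Lemma scale_add_small (c : C) : exists2 d : R, 0 < d & forall (e : R) f g,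
  0 < e -> conv_algebra f -> conv_algebra g ->
  (unorm Gd f < (d * e)%:E -> unorm Gd g < (e / 2)%:E ->
  unorm Gd (c *: f + g)%R < e%:E)%E.
Proof.
have cge0 : 0 <= complex.Re `|c| by rewrite normc_def /= sqrtr_ge0.
set k := complex.Re `|c| in cge0; exists (2 * (k + 1))^-1.
  by rewrite invr_gt0 mulr_gt0 // ltr_wpDl.
move=> e f g e0 hf hg hf' hg'.
apply: le_lt_trans (unorm_scale_add _ hf hg) _.
rewrite -/k (splitr e) EFinD; apply: lteD => //.
apply: (@le_lt_trans _ _ (k%:E * ((2 * (k + 1))^-1 * e)%:E)%E).
  by apply: lee_wpmul2l; rewrite ?lee_fin // ltW.
rewrite -EFinM lte_fin mulrA mulrC ltr_pM2l //.
by rewrite ltr_pdivrMr ?mulr_gt0 ?ltr_wpDl // mulrA mulVf // mul1r ltrDl.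
Qed.

Lemma cauchy_submod : submod_closed cauchy_pred.
Proof.
split=> [|c u v]; rewrite !unfold_in.
  apply/asboolP; split=> [n|e e0]; first exact: conv_algebra0.
  exists 0%N => m n _ _; rewrite subrr.
  by apply: le_lt_trans unorm0 _; rewrite lte_fin.
move=> /asboolP[uA uC] /asboolP[vA vC]; apply/asboolP; split=> [n|e e0].
  exact: conv_algebraP.
have [d d0 hd] := scale_add_small c.
have [N1 hN1] := uC _ (mulr_gt0 d0 e0).
have [N2 hN2] := vC _ (divr_gt0 e0 (ltr0Sn _ 1)).
exists (maxn N1 N2) => m n; rewrite !geq_max => /andP[m1 m2] /andP[n1 n2].
rewrite (_ : _ - _ = c *: (u m - u n) + (v m - v n)); last first.
  by rewrite scalerBr opprD addrACA.
apply: hd => //; [exact: conv_algebraB|exact: conv_algebraB|exact: hN1|].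
exact: hN2.
Qed.

HB.instance Definition _ := GRing.isSubmodClosed.Build R[i] (nat -> G -> C)
  cauchy_pred cauchy_submod.

Record cauchy_seq := CauchySeq {
  cauchy_val : nat -> G -> C;
  _ : cauchy_val \in cauchy_pred
}.

HB.instance Definition _ := [isSub for cauchy_val].
HB.instance Definition _ := [Choice of cauchy_seq by <:].
HB.instance Definition _ := [SubChoice_isSubLmodule of cauchy_seq by <:].

Definition null_pred : {pred cauchy_seq} := fun u => `[< null (\val u) >].

Lemma null_submod : submod_closed null_pred.
Proof.
split=> [|c u v]; rewrite !unfold_in.
  apply/asboolP => e e0; exists 0%N => n _.
  by apply: le_lt_trans unorm0 _; rewrite lte_fin.
move=> /asboolP un /asboolP vn; apply/asboolP => e e0.
have [d d0 hd] := scale_add_small c.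
have [N1 hN1] := un _ (mulr_gt0 d0 e0).
have [N2 hN2] := vn _ (divr_gt0 e0 (ltr0Sn _ 1)).
have /asboolP[uA _] := valP u; have /asboolP[vA _] := valP v.
exists (maxn N1 N2) => n; rewrite geq_max => /andP[n1 n2].
rewrite linearP.
change ((c *: \val u + \val v) n) with (c *: \val u n + \val v n).
exact: hd (uA n) (vA n) (hN1 _ n1) (hN2 _ n2).
Qed.

HB.instance Definition _ := GRing.isSubmodClosed.Build R[i] cauchy_seq
  null_pred null_submod.

(* The completion of [conv_algebra] in [unorm]: Cauchy sequences modulo null
   sequences. *)
Definition Cstar := Quotient.quot null_pred.

HB.instance Definition _ := GRing.Zmodule.on Cstar.

Definition Cstar_scale (c : R[i]) (a : Cstar) : Cstar := \pi_Cstar (c *: repr a).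

Lemma pi_class_add (u v : cauchy_seq) :
  \pi_Cstar (u + v) = \pi_Cstar u + \pi_Cstar v.
Proof. exact: Quotient.pi_add. Qed.

Lemma pi_scale (c : R[i]) (u : cauchy_seq) :
  Cstar_scale c (\pi_Cstar u) = \pi_Cstar (c *: u).
Proof.
apply/eqP; rewrite -Quotient.idealrBE -scalerBr rpredZ //.
by rewrite Quotient.idealrBE reprK.
Qed.

Lemma Cstar_scaleA (b c : R[i]) (a : Cstar) :
  Cstar_scale b (Cstar_scale c a) = Cstar_scale (b * c) a.
Proof. by rewrite -[a]reprK !pi_scale scalerA reprK. Qed.

Lemma Cstar_scale1 : left_id 1 Cstar_scale.
Proof. by move=> a; rewrite -[a]reprK pi_scale scale1r reprK. Qed.

Lemma Cstar_scaleDr : right_distributive Cstar_scale +%R.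
Proof.
move=> c a b; rewrite -[a]reprK -[b]reprK.
by rewrite !pi_scale -!pi_class_add pi_scale scalerDr.
Qed.

Lemma Cstar_scaleDl (a : Cstar) :
  {morph Cstar_scale^~ a : b c / b + c >-> b + c}.
Proof.
move=> b c; rewrite -[a]reprK.
by rewrite !pi_scale -pi_class_add scalerDl.
Qed.

HB.instance Definition _ := GRing.Zmodule_isLmodule.Build R[i] Cstar
  Cstar_scaleA Cstar_scale1 Cstar_scaleDr Cstar_scaleDl.

(* The class of a Cauchy sequence; 0 on the sequences that are not Cauchy. *)
Definition Cstar_class (u : nat -> G -> C) : Cstar := \pi_Cstar (insubd 0 u).

Definition Cstar_repr (a : Cstar) : nat -> G -> C := \val (repr a).

(* The termwise product of Cauchy sequences in [conv_algebra] is Cauchy and its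
   class does not depend on the representatives. *)
Definition Cstar_mul (a b : Cstar) : Cstar :=
  Cstar_class (fun n => conv Gd (Cstar_repr a n) (Cstar_repr b n)).

Definition Cstar_norm (a : Cstar) : \bar R :=
  limn (fun n => unorm Gd (Cstar_repr a n)).

Definition C0_units : set (G -> C) :=
  [set h | [/\ forall x, ~ units Gd x -> h x = 0,
               {within units Gd, continuous h} &
               forall e : R, 0 < e ->
                 compact [set x | units Gd x /\ e%:C%C <= `|h x|]]].

(* The image of [C0_units] under the continuous extension of the inclusion of
   [Cc (units Gd)]: a function is sent to the limit of any sequence in
   [Cc (units Gd)] converging to it uniformly. *)
Definition Cstar_C0 : set Cstar :=
  [set a | exists2 h, C0_units h & exists u : cauchy_seq,
    [/\ forall n, Cc (units Gd) (\val u n),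
        forall e : R, 0 < e -> exists N : nat, forall n : nat,
          (N <= n)%N -> forall x, `|\val u n x - h x| < e%:C%C &
        a = \pi_Cstar u]].

Record closed_ideal (I : set Cstar) : Prop := ClosedIdeal {
  closed_ideal0 : I 0;
  closed_idealD : forall a b, I a -> I b -> I (a + b);
  closed_idealZ : forall (c : R[i]) a, I a -> I (c *: a);
  closed_idealMl : forall a b, I b -> I (Cstar_mul a b);
  closed_idealMr : forall a b, I a -> I (Cstar_mul a b);
  closed_ideal_closed : forall a, (forall e : R, 0 < e ->
    exists2 b, I b & (Cstar_norm (a - b)%R < e%:E)%E) -> I a
}.

Definition full_uniqueness_property : Prop :=
  forall I : set Cstar, closed_ideal I -> I <> [set 0] ->
    I `&` Cstar_C0 <> [set 0].

End GroupoidCstar.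

Arguments full_uniqueness_property R {G} Gd.

(* Main.v *)
(* If [a] is a non-unit in the interior of the isotropy, pick an open bisection
   [B] around [a] inside the isotropy, a bump function [h] on [src B] with
   [h (src a) = 1], and let [f] and [f'] be [h] transported to [B] and to the
   units.  As [B] consists of isotropy, [f] and [f'] act in the same way on
   l2(units), where [b] moves the point mass at [src b] to [rng b].  So
   [f - f'] is in the kernel of that representation, and it is not 0 because
   [f a <> f' a] is seen by the left regular representation on l2(G).  But the
   kernel meets C_0(units) trivially: [C_0(units)] acts on l2(units) by
   multiplication. *)
From HB Require Import structures.
From mathcomp Require Import all_boot all_order all_algebra.
From mathcomp Require Import generic_quotient ring_quotient.
From mathcomp Require Import all_classical all_reals all_analysis.
From mathcomp Require Import complex ring lra.
(* Last, since [conv] is also the name of a convexity notion of MathComp-Analysis. *)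
Require Import Defs.

Set Implicit Arguments.
Unset Strict Implicit.
Unset Printing Implicit Defensive.

Import Order.TTheory GRing.Theory Num.Theory numFieldNormedType.Exports.

Local Open Scope classical_set_scope.
Local Open Scope ring_scope.
Local Open Scope quotient_scope.

(** * Unordered sums of real families *)

(** As [G] may fail to be Hausdorff, [f - f'] need be neither continuous nor supported in one
    Hausdorff open set; that it survives in the completion is therefore tested on its single value
    at [a], where [f] is 1 and [f'] vanishes because [a] is not a unit. That the kernel meets
    C_0(units) trivially has two halves. Acting by multiplication on point masses shows that the
    limit function is 0; that its class is then 0 in the universal completion requires every
    representation to be contractive for the sup norm on [Cc (units Gd)], which is
    [rep_Cc_units_le]. Since the completion consists of Cauchy sequences modulo null ones, the
    kernel is described by norm decay along representatives, and [rho] is never extended to the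
    completion. Both representations come from one construction attached to a groupoid action: a
    function on a bisection acts as a weighted partial injection, which gives boundedness and the
    adjoint at once. The index sets may be uncountable, hence the unordered sums. *)

Section UnorderedSums.
Context (R : realType).
Implicit Types (X Y : choiceType).

(** [fine] turns an infinite sum into [0], so additivity and scaling below ask for [rsummable]. *)
Definition psum X (F : X -> R) : R := fine (\esum_(x in [set: X]) (F x)%:E).

Definition rsummable X (F : X -> R) : Prop :=
  (\esum_(x in [set: X]) `|F x|%:E < +oo)%E.

Definition rsum X (F : X -> R) : R :=
  psum (fun x => Num.max (F x) 0) - psum (fun x => Num.max (- F x) 0).

Lemma rsummable_le X (F G : X -> R) :
  rsummable G -> (forall x, `|F x| <= G x) -> rsummable F.
Proof.
move=> sG FG; apply: le_lt_trans sG; apply: le_esum => x _.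
by rewrite lee_fin (le_trans (FG x)) // ler_norm.
Qed.

Lemma rsummableD X (F G : X -> R) :
  rsummable F -> rsummable G -> rsummable (fun x => F x + G x).
Proof.
move=> sF sG; apply: (@le_lt_trans _ _
  (\esum_(x in [set: X]) (`|F x|%:E + `|G x|%:E))%E).
  by apply: le_esum => x _; rewrite -EFinD lee_fin ler_normD.
by rewrite esumD ?lte_add_pinfty // => x _; rewrite lee_fin.
Qed.

Lemma rsummable_psum X (F : X -> R) :
  (forall x, 0 <= F x) -> rsummable F ->
  (\esum_(x in [set: X]) (F x)%:E)%E = (psum F)%:E.
Proof.
move=> F0 sF; rewrite /psum fineK // ge0_fin_numE.
  by apply: le_lt_trans sF; apply: le_esum => x _; rewrite lee_fin ler_norm.
by apply: esum_ge0 => x _; rewrite lee_fin.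
Qed.

Lemma psum_ge0 X (F : X -> R) : (forall x, 0 <= F x) -> 0 <= psum F.
Proof.
by move=> F0; apply/fine_ge0/esum_ge0 => x _; rewrite lee_fin.
Qed.

Lemma psumD X (F G : X -> R) :
  (forall x, 0 <= F x) -> (forall x, 0 <= G x) ->
  rsummable F -> rsummable G ->
  psum (fun x => F x + G x) = psum F + psum G.
Proof.
move=> F0 G0 sF sG; apply: EFin_inj; rewrite EFinD -!rsummable_psum //.
- by rewrite -esumD //; move=> x _; rewrite lee_fin.
- by move=> x; rewrite addr_ge0.
- exact: rsummableD.
Qed.

Lemma rsummable_max X (F : X -> R) :
  rsummable F -> rsummable (fun x => Num.max (F x) 0).
Proof.
move=> sF; apply: (@rsummable_le _ _ (fun x => `|F x|)).
  by rewrite /rsummable; under eq_esum do rewrite normr_id.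
by move=> x; case: (leP (F x) 0); rewrite ?normr0.
Qed.

Lemma rsummableN X (F : X -> R) : rsummable F -> rsummable (fun x => - F x).
Proof. by rewrite /rsummable; under eq_esum do rewrite -normrN. Qed.

Lemma rsummableZ X (c : R) (F : X -> R) :
  rsummable F -> rsummable (fun x => c * F x).
Proof.
move=> sF; pose n := Num.bound `|c|.
(* Additivity alone gives natural multiples; [|c|] is then dominated by the natural number [n]. *)
have h m : rsummable (fun x => m%:R * `|F x|).
  elim: m => [|m ih].
    by rewrite /rsummable esum1 ?ltry // => x _; rewrite mul0r normr0.
  apply: (@rsummable_le _ _ (fun x => m%:R * `|F x| + `|F x|)).
    apply: rsummableD => //.
    by rewrite /rsummable; under eq_esum do rewrite normr_id.
  by move=> x; rewrite mulrS [1 + _]addrC mulrDl mul1r ger0_norm //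
    addr_ge0 // mulr_ge0.
apply: (rsummable_le (h n)) => x.
by rewrite normrM ler_wpM2r // ltW // archi_boundP.
Qed.

Lemma max0rE (x : R) : Num.max x 0 = x + Num.max (- x) 0.
Proof.
by case: (leP x 0) => x0; case: (leP (- x) 0) => x1; lra.
Qed.

(** Positive parts are not additive, so linearity of [rsum] goes through arbitrary splittings
    [A - B]: cross-adding turns the claim into an equality between sums of nonnegative families. *)
Lemma rsumE X (A B F : X -> R) :
  (forall x, 0 <= A x) -> (forall x, 0 <= B x) ->
  rsummable A -> rsummable B -> (forall x, F x = A x - B x) ->
  rsum F = psum A - psum B.
Proof.
move=> A0 B0 sA sB FE.
have sF : rsummable F.
  apply: (rsummable_le (rsummableD sA sB)) => x.
  by rewrite FE (le_trans (ler_normB _ _)) // !ger0_norm.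
have sF' := rsummableN sF.
apply/eqP; rewrite subr_eq addrAC eq_sym subr_eq; apply/eqP.
rewrite -!psumD //; last 4 first.
- by move=> x; rewrite le_max lexx orbT.
- exact: rsummable_max.
- by move=> x; rewrite le_max lexx orbT.
- exact: (rsummable_max sF').
congr psum; apply/funext => x; rewrite [in RHS]max0rE FE; ring.
Qed.


Lemma rsumD X (F G : X -> R) : rsummable F -> rsummable G ->
  rsum (fun x => F x + G x) = rsum F + rsum G.
Proof.
move=> sF sG; have sF' := rsummableN sF; have sG' := rsummableN sG.
have m0 (H : X -> R) x : 0 <= Num.max (H x) 0 by rewrite le_max lexx orbT.
pose p (H : X -> R) x := Num.max (H x) 0.
rewrite (@rsumE X (fun x => p F x + p G x)
  (fun x => p (fun x => - F x) x + p (fun x => - G x) x)).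
- rewrite !psumD //; try exact: rsummable_max; try exact: m0.
  by rewrite /rsum opprD addrACA.
- by move=> x; rewrite addr_ge0 // m0.
- by move=> x; rewrite addr_ge0 // m0.
- by apply: rsummableD; exact: rsummable_max.
- by apply: rsummableD; apply: (@rsummable_max _ (fun x => - _ x)).
- by move=> x; rewrite /p (max0rE (F x)) (max0rE (G x)); ring.
Qed.

Lemma rsum_ge0E X (F : X -> R) : (forall x, 0 <= F x) -> rsum F = psum F.
Proof.
move=> F0; rewrite /rsum (_ : (fun x => Num.max (F x) 0) = F); last first.
  by apply/funext => x; apply/max_idPl.
have -> : (fun x => Num.max (- F x) 0) = fun=> 0.
  by apply/funext => x; apply/max_idPr; rewrite oppr_le0.
by rewrite [X in _ - X](_ : _ = 0) ?subr0 // /psum esum1.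
Qed.

Lemma rsumN X (F : X -> R) : rsum (fun x => - F x) = - rsum F.
Proof.
rewrite /rsum opprB; congr (_ - psum _); apply/funext => x.
by rewrite opprK.
Qed.

Lemma psumZ X (c : R) (F : X -> R) : 0 <= c ->
  (forall x, 0 <= F x) -> rsummable F ->
  psum (fun x => c * F x) = c * psum F.
Proof.
move=> c0 F0 sF; apply: EFin_inj; rewrite -rsummable_psum; last 2 first.
- by move=> x; rewrite mulr_ge0.
- exact: rsummableZ.
(* One inequality suffices: applied to [c^-1] and [c * F] it gives the reverse one. *)
have h (d : R) (H : X -> R) : 0 <= d -> rsummable H -> (forall x, 0 <= H x) ->
    (\esum_(x in [set: X]) (d * H x)%:E <= (d * psum H)%:E)%E.
  move=> d0 sH H0; rewrite ge_ereal_sup // => _ [A [finA _] <-].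
  rewrite fsumEFin // lee_fin -mulr_fsumr ler_wpM2l //.
  rewrite -lee_fin -rsummable_psum // -fsumEFin //.
  by apply: ereal_sup_ubound; exists A.
apply/eqP; rewrite eq_le h //=; have [->|cn0] := eqVneq c 0.
  by rewrite mul0r; apply: esum_ge0 => x _; rewrite mul0r.
have c1 : 0 <= c^-1 by rewrite invr_ge0.
have scF := rsummableZ c sF.
have := @h c^-1 (fun x => c * F x) c1 scF (fun x => mulr_ge0 c0 (F0 x)).
rewrite (_ : (fun x => _) = fun x => (F x)%:E); last first.
  by apply/funext => x; rewrite mulKf.
rewrite (rsummable_psum F0 sF) lee_fin => hh.
rewrite (rsummable_psum _ scF) ?lee_fin; last by move=> x; rewrite mulr_ge0.
by rewrite mulrC -ler_pdivlMr ?lt_def ?cn0 // mulrC.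
Qed.

Lemma rsumZ X (c : R) (F : X -> R) : rsummable F ->
  rsum (fun x => c * F x) = c * rsum F.
Proof.
move=> sF.
wlog c0 : c / 0 <= c => [h|].
  have [c0|c0] := leP 0 c; first exact: h.
  rewrite -[c]opprK mulNr -(h (- c)) ?oppr_ge0 ?ltW // -rsumN.
  by congr rsum; apply/funext => x; rewrite mulNr.
have sF' := rsummableN sF.
have m0 (H : X -> R) x : 0 <= Num.max (H x) 0 by rewrite le_max lexx orbT.
rewrite (@rsumE X (fun x => c * Num.max (F x) 0)
  (fun x => c * Num.max (- F x) 0)).
- rewrite !psumZ //; try exact: m0; first by rewrite /rsum mulrBr.
  + exact: (rsummable_max sF').
  + exact: rsummable_max.
- by move=> x; rewrite mulr_ge0 // le_max lexx orbT.
- by move=> x; rewrite mulr_ge0 // le_max lexx orbT.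
- by apply: rsummableZ; exact: rsummable_max.
- by apply: rsummableZ; exact: (rsummable_max sF').
- by move=> x; rewrite -mulrBr; congr (_ * _); rewrite (max0rE (F x)); ring.
Qed.

(** The form suited to bisections: they move points along injections that are only partially
    defined, hence [A] and the vanishing outside it. *)
Lemma rsum_reindex X Y (A : set X) (e : X -> Y) (F : X -> R) (G : Y -> R) :
  set_inj A e -> (forall x, ~ A x -> F x = 0) ->
  (forall y, ~ (e @` A) y -> G y = 0) -> (forall x, A x -> F x = G (e x)) ->
  rsum F = rsum G.
Proof.
move=> ei F0 G0 FG.
(* Used for the positive and the negative part; [u 0 = 0] preserves the vanishing outside [A] and
   its image. *)
have h (u : R -> R) : u 0 = 0 ->
    psum (fun x => u (F x)) = psum (fun y => u (G y)).
  move=> u0; congr fine.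
  transitivity (\esum_(x in A) (u (F x))%:E)%E.
    rewrite [RHS]esum_mkcond; apply: eq_esum => x _; case: ifPn => //.
    by rewrite notin_setE => /F0 ->; rewrite u0.
  transitivity (\esum_(y in e @` A) (u (G y))%:E)%E.
    by rewrite esum_image //; apply: eq_esum => x /FG ->.
  rewrite [LHS]esum_mkcond; apply: eq_esum => x _; case: ifPn => //.
  by rewrite notin_setE => /G0 ->; rewrite u0.
rewrite /rsum (h (fun t => Num.max t 0)) ?maxxx //.
by rewrite (h (fun t => Num.max (- t) 0)) ?oppr0 ?maxxx.
Qed.

End UnorderedSums.

(** * The Hilbert space of square-summable families *)

Section SquareSummable.
Context (R : realType) (X : choiceType).
Local Notation C := (R[i]^o).
Implicit Types F : X -> C.

Definition csum F : C :=
  (rsum (fun x => complex.Re (F x)) +i* rsum (fun x => complex.Im (F x)))%C.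

Definition csummable F : Prop :=
  rsummable (fun x => complex.Re (F x)) /\
  rsummable (fun x => complex.Im (F x)).

Lemma csumD F G : csummable F -> csummable G ->
  csum (fun x => F x + G x) = csum F + csum G.
Proof.
move=> [F1 F2] [G1 G2]; apply/eqP; rewrite eq_complex /=.
rewrite -!rsumD //; apply/andP; split; apply/eqP; congr rsum;
  by apply/funext => x; case: (F x) (G x) => a b [].
Qed.

Lemma csumZ (c : R[i]) F : csummable F ->
  csum (fun x => c * F x) = c * csum F.
Proof.
case: c => a b [F1 F2].
have F1' r := rsummableZ r F1; have F2' r := rsummableZ r F2.
apply/eqP; rewrite eq_complex /= -!rsumZ // -rsumN -!rsumD //; last first.
  exact: rsummableN.
by apply/andP; split; apply/eqP; congr rsum; apply/funext => x;
  case: (F x) => u v /=; rewrite // addrC.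
Qed.

Lemma csum_conj F : csum (fun x => Num.conj (F x)) = Num.conj (csum F).
Proof.
apply/eqP; rewrite eq_complex /=; apply/andP; split; apply/eqP.
  by congr rsum; apply/funext => x; case: (F x).
by rewrite -rsumN; congr rsum; apply/funext => x; case: (F x).
Qed.

(** The squared modulus with values in [R], as the unordered sums are over real families whereas the
    norm of [C] takes values in [R[i]]. *)
Definition sqnorm (z : C) : R := complex.Re z ^+ 2 + complex.Im z ^+ 2.

Lemma sqnorm_ge0 z : 0 <= sqnorm z.
Proof. by rewrite addr_ge0 // sqr_ge0. Qed.

Lemma sqnormM (y z : C) : sqnorm (y * z) = sqnorm y * sqnorm z.
Proof. by case: y z => a b [c d]; rewrite /sqnorm /=; ring. Qed.

Lemma sqnormD_le (y z : C) : sqnorm (y + z) <= 2 * sqnorm y + 2 * sqnorm z.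
Proof. case: y z => a b [c d]; rewrite /sqnorm /=.
by have := sqr_ge0 (a - c); have := sqr_ge0 (b - d); nra. Qed.

Lemma sqnorm_eq0 (z : C) : (sqnorm z == 0) = (z == 0).
Proof.
case: z => a b; rewrite eq_complex /sqnorm /= paddr_eq0 ?sqr_ge0 //.
by rewrite !sqrf_eq0.
Qed.

Definition l2_pred : {pred X -> C} :=
  fun xi => `[< rsummable (fun x => sqnorm (xi x)) >].

Lemma rsummable_sqnorm_le (xi : X -> C) (F : X -> R) : rsummable F ->
  (forall x, sqnorm (xi x) <= F x) -> xi \in l2_pred.
Proof.
move=> sF le_F; apply/asboolP; apply: (rsummable_le sF) => x.
by rewrite ger0_norm ?sqnorm_ge0.
Qed.

Lemma l2_submod : submod_closed l2_pred.
Proof.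
split=> [|c u v]; rewrite ?[_ \in l2_pred]unfold_in.
  apply/asboolP; rewrite /rsummable esum1 ?ltry // => x _.
  by rewrite /sqnorm /= !expr0n /= addr0 normr0.
move=> /asboolP su /asboolP sv.
apply: (rsummable_sqnorm_le (rsummableD (rsummableZ (2 * sqnorm c) su)
  (rsummableZ 2 sv))) => x.
by apply: le_trans (sqnormD_le _ _) _; rewrite sqnormM mulrA.
Qed.

HB.instance Definition _ := GRing.isSubmodClosed.Build R[i] (X -> C)
  l2_pred l2_submod.

Record l2 := L2 { l2_val : X -> C; _ : l2_val \in l2_pred }.

HB.instance Definition _ := [isSub for l2_val].
HB.instance Definition _ := [Choice of l2 by <:].
HB.instance Definition _ := [SubChoice_isSubLmodule of l2 by <:].

Implicit Types xi eta : l2.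

Lemma l2P xi : rsummable (fun x => sqnorm (\val xi x)).
Proof. exact/asboolP/(valP xi). Qed.

Definition l2_dot (xi eta : l2) : R[i] :=
  csum (fun x => \val xi x * Num.conj (\val eta x)).

(** By [2|st| <= s^2 + t^2], both parts of each product are at most the sum of the two squared
    moduli. *)
Lemma l2_dot_summable xi eta :
  csummable (fun x => \val xi x * Num.conj (\val eta x)).
Proof.
have h := rsummableD (l2P xi) (l2P eta); split; apply: (rsummable_le h) => x.
  case: (\val xi x) (\val eta x) => a b [c d] /=; rewrite /sqnorm /= ler_norml.
  have := sqr_ge0 (a + c); have := sqr_ge0 (a - c).
  have := sqr_ge0 (b + d); have := sqr_ge0 (b - d) => *.
  by apply/andP; split; nra.
case: (\val xi x) (\val eta x) => a b [c d] /=; rewrite /sqnorm /= ler_norml.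
have := sqr_ge0 (a + d); have := sqr_ge0 (a - d).
have := sqr_ge0 (b + c); have := sqr_ge0 (b - c) => *.
by apply/andP; split; nra.
Qed.

Lemma l2_dotC xi eta : l2_dot xi eta = Num.conj (l2_dot eta xi).
Proof.
rewrite /l2_dot -csum_conj; congr csum; apply/funext => x.
by rewrite rmorphM /= conjCK mulrC.
Qed.

Lemma l2_dot_linearl eta : scalar (fun xi => l2_dot xi eta).
Proof.
move=> c xi zeta; have h := l2_dot_summable.
rewrite /l2_dot -csumZ // -csumD //.
  by congr csum; apply/funext => x; rewrite mulrA -mulrDl linearP.
have := h (c *: xi) eta; rewrite linearZ /=.
by congr csummable; apply/funext => x; rewrite mulrA.
Qed.

Lemma l2_dot_bilinear :
  bilinear_for *%R (Num.conj \; *%R) l2_dot.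
Proof.
split=> [eta|xi c u v]; first exact: l2_dot_linearl.
rewrite l2_dotC l2_dot_linearl rmorphD rmorphM /=.
by rewrite -!l2_dotC.
Qed.

HB.instance Definition _ := bilinear_isBilinear.Build R[i] l2 l2 R[i]
  *%R (Num.conj \; *%R) l2_dot l2_dot_bilinear.

Lemma l2_dot_hermitian xi eta :
  l2_dot xi eta = (-1) ^+ false * Num.conj (l2_dot eta xi).
Proof. by rewrite expr0 mul1r l2_dotC. Qed.

HB.instance Definition _ := isHermitianSesquilinear.Build R[i] l2
  false Num.conj l2_dot l2_dot_hermitian.

Lemma l2_dotxx xi :
  l2_dot xi xi = (psum (fun x => sqnorm (\val xi x)))%:C%C.
Proof.
apply/eqP; rewrite eq_complex /= -rsum_ge0E; last by move=> x; exact: sqnorm_ge0.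
apply/andP; split; apply/eqP.
  congr rsum; apply/funext => x; case: (\val xi x) => a b /=.
  by rewrite /sqnorm /=; ring.
rewrite rsum_ge0E => [|x].
  rewrite /psum esum1 // => x _.
  by case: (\val xi x) => a b /=; congr (_%:E); ring.
by case: (\val xi x) => a b /=; rewrite le_eqVlt; apply/orP; left; apply/eqP;
  ring.
Qed.

Lemma sqnorm_le_psum xi x :
  sqnorm (\val xi x) <= psum (fun x => sqnorm (\val xi x)).
Proof.
rewrite -lee_fin -rsummable_psum; [|by move=> y; exact: sqnorm_ge0|exact: l2P].
apply: esum_ge; exists [set x]; first by split.
by rewrite fsbig_set1.
Qed.

Lemma l2_dot_gt0 xi : xi != 0 -> 0 < l2_dot xi xi.
Proof.
move=> xi0; rewrite l2_dotxx ltcR lt_def psum_ge0 ?andbT; last first.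
  by move=> x; exact: sqnorm_ge0.
apply: contra xi0 => /eqP h; apply/eqP/val_inj/funext => x /=.
apply/eqP; rewrite -sqnorm_eq0 eq_le sqnorm_ge0 andbT -h.
exact: sqnorm_le_psum.
Qed.

HB.instance Definition _ := isDotProduct.Build R[i] l2 l2_dot l2_dot_gt0.

Definition l2_form : {dot l2 for (@Num.conj R[i])} := l2_dot.

Lemma l2_normE xi :
  dot_norm l2_form xi = Num.sqrt (psum (fun x => sqnorm (\val xi x))).
Proof. by rewrite /dot_norm [l2_form _ _]l2_dotxx. Qed.

(** The extended sum is a supremum over finite sets, so norm bounds can be checked, and passed to a
    limit, one finite set at a time. *)
Lemma l2_norm_le xi (M : R) : 0 <= M ->
  (dot_norm l2_form xi <= M) =
  (\esum_(x in [set: X]) (sqnorm (\val xi x))%:E <= (M ^+ 2)%:E)%E.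
Proof.
move=> M0; rewrite rsummable_psum; [|by move=> y; exact: sqnorm_ge0|exact: l2P].
rewrite l2_normE lee_fin -[in LHS](ger0_norm M0) -[in LHS]sqrtr_sqr ler_sqrt //.
exact: sqr_ge0.
Qed.

Lemma sqnorm_le_norm xi x : sqnorm (\val xi x) <= dot_norm l2_form xi ^+ 2.
Proof.
rewrite l2_normE sqr_sqrtr; first exact: sqnorm_le_psum.
by apply: psum_ge0 => y; exact: sqnorm_ge0.
Qed.


Lemma cauchy_real_cvgn (v : nat -> R) :
  (forall e : R, 0 < e -> exists N : nat, forall m n : nat,
     (N <= m)%N -> (N <= n)%N -> `|v m - v n| < e) -> cvgn v.
Proof.
move=> vC; apply/cauchy_cvgP/cauchy_exP => e e0.
have [N hN] := vC e e0; exists (v N); exists N => // n /= Nn.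
exact: hN.
Qed.

Lemma cvg_sum_seq (v : nat -> X -> R) (w : X -> R) (r : seq X) :
  (forall x, v n x @[n --> \oo] --> w x) ->
  \sum_(x <- r) v n x @[n --> \oo] --> \sum_(x <- r) w x.
Proof.
move=> vw; elim: r => [|x r ih].
  by rewrite big_nil; under eq_fun do rewrite big_nil; exact: cvg_cst.
rewrite big_cons; under eq_fun do rewrite big_cons.
exact: cvgD.
Qed.

Lemma l2_complete (u : nat -> l2) :
  (forall e : R, 0 < e -> exists N : nat, forall m n : nat,
     (N <= m)%N -> (N <= n)%N -> dot_norm l2_form (u m - u n) < e) ->
  exists l : l2, forall e : R, 0 < e -> exists N : nat,
    forall n : nat, (N <= n)%N -> dot_norm l2_form (u n - l) < e.
Proof.
move=> uC.
have valB m n x : \val (u m - u n) x = \val (u m) x - \val (u n) x.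
  by rewrite linearB.
(* [part] is the real or the imaginary part; each coordinate is controlled by the norm. *)
have part_cvg (part : C -> R) : (forall y z, part (y - z) = part y - part z) ->
    (forall z, part z ^+ 2 <= sqnorm z) -> forall x,
    cvgn (fun n => part (\val (u n) x)).
  move=> partB part_le x; apply: cauchy_real_cvgn => e e0.
  have [N hN] := uC e e0; exists N => m n Nm Nn.
  apply: le_lt_trans (hN m n Nm Nn).
  rewrite -partB -valB -(ler_pXn2r (_ : 0 < 2)%N) ?nnegrE ?sqrtr_ge0 //.
  rewrite real_normK ?num_real //.
  exact: le_trans (part_le _) (sqnorm_le_norm _ _).
have ReB (y z : C) : complex.Re (y - z) = complex.Re y - complex.Re z.
  by case: y z => a b [].
have ImB (y z : C) : complex.Im (y - z) = complex.Im y - complex.Im z.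
  by case: y z => a b [].
have cre x : cvgn (fun n => complex.Re (\val (u n) x)).
  by apply: part_cvg ReB _ x => z; rewrite lerDl sqr_ge0.
have cim x : cvgn (fun n => complex.Im (\val (u n) x)).
  by apply: part_cvg ImB _ x => z; rewrite lerDr sqr_ge0.
pose l x : C := (limn (fun n => complex.Re (\val (u n) x)) +i*
  limn (fun n => complex.Im (\val (u n) x)))%C.
have sq_cvg n x :
    sqnorm (\val (u n) x - \val (u m) x) @[m --> \oo] -->
    sqnorm (\val (u n) x - l x).
  rewrite /sqnorm; apply: cvgD.
    rewrite ReB expr2; under eq_fun do rewrite ReB expr2.
    by apply: cvgM; apply: cvgB; [exact: cvg_cst|exact: cre
                                 |exact: cvg_cst|exact: cre].
  rewrite ImB expr2; under eq_fun do rewrite ImB expr2.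
  by apply: cvgM; apply: cvgB; [exact: cvg_cst|exact: cim
                               |exact: cvg_cst|exact: cim].
(* On a finite set of indices the Cauchy estimate for [u n - u m] passes to the limit in [m], and
   the supremum over finite sets keeps the bound, as in Fatou's lemma. *)
have tail (e : R) : 0 < e -> exists N : nat, forall n : nat, (N <= n)%N ->
    (\esum_(x in [set: X]) (sqnorm (\val (u n) x - l x))%:E <= (e ^+ 2)%:E)%E.
  move=> e0; have [N hN] := uC e e0; exists N => n Nn.
  rewrite ge_ereal_sup // => _ [A [finA _] <-].
  rewrite fsbig_finite // sumEFin lee_fin.
  apply: (cvgr_to_le (cvg_sum_seq (sq_cvg n))).
  exists N => // m /= Nm.
  have := ltW (hN n m Nn Nm); rewrite l2_norm_le ?(ltW e0) // => h.
  rewrite -lee_fin; apply: le_trans h; apply: esum_ge; exists A => //.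
  rewrite fsbig_finite // sumEFin lee_fin; apply: ler_sum => x _.
  by rewrite valB.
(* [l] is [u N] minus a difference of norm at most [1]. *)
have lS : l \in l2_pred.
  have [N hN] := tail 1 ltr01.
  have dS : (\val (u N) - l) \in l2_pred.
    apply/asboolP; apply: le_lt_trans (ltry (1 ^+ 2)).
    apply: le_trans (hN N (leqnn N)); apply: le_esum => x _.
    by rewrite ger0_norm ?sqnorm_ge0.
  rewrite -[l](subKr (\val (u N))); apply: rpredB => //; exact: valP.
(* [tail] gives a weak inequality; half of [e] makes it strict. *)
exists (L2 lS) => e e0; have [N hN] := tail _ (divr_gt0 e0 (ltr0Sn _ 1)).
exists N => n Nn; apply: (@le_lt_trans _ _ (e / 2)); last first.
  by rewrite ltr_pdivrMr // ltr_pMr // ltr1n.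
rewrite l2_norm_le ?divr_ge0 ?(ltW e0) //; apply: le_trans (hN n Nn).
by apply: le_esum => x _; rewrite linearB.
Qed.

Definition l2_hilbert : hilbert R := Hilbert l2_complete.

End SquareSummable.

(** * Groupoid actions and functions supported on bisections *)

Lemma csum_reindex (R : realType) (X Y : choiceType) (A : set X) (e : X -> Y)
    (F : X -> R[i]^o) (G : Y -> R[i]^o) :
  set_inj A e -> (forall x, ~ A x -> F x = 0) ->
  (forall y, ~ (e @` A) y -> G y = 0) -> (forall x, A x -> F x = G (e x)) ->
  csum F = csum G.
Proof.
move=> ei F0 G0 FG; apply/eqP; rewrite eq_complex /=.
by apply/andP; split; apply/eqP; apply: (rsum_reindex ei) => [x|y|x] /=;
  do ?[move=> /F0 ->|move=> /G0 ->|move=> /FG ->].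
Qed.

Section GroupoidBasics.
Context (G : Type) (Gd : groupoid G).

Lemma gmulVK a b : src Gd a = rng Gd b ->
  gmul Gd (ginv Gd a) (gmul Gd a b) = b.
Proof.
by move=> ab; rewrite gmulA ?src_ginv // gmulVl ab gmul_unitl.
Qed.

Lemma gmulKV a b : src Gd a = rng Gd b ->
  gmul Gd (gmul Gd a b) (ginv Gd b) = a.
Proof.
by move=> ab; rewrite -gmulA ?rng_ginv // gmulV -ab gmul_unitr.
Qed.

Lemma ginv_unit (x : units Gd) : ginv Gd (\val x) = \val x.
Proof.
have := gmul_unitl Gd (ginv Gd (\val x)).
by rewrite rng_ginv src_unit gmulV rng_unit.
Qed.

Lemma ginvK : involutive (ginv Gd).
Proof.
move=> a; rewrite -[LHS](gmul_unitr Gd) src_ginv rng_ginv -gmulVl.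
by rewrite gmulVK // src_ginv.
Qed.

Lemma ginvM a b : src Gd a = rng Gd b ->
  ginv Gd (gmul Gd a b) = gmul Gd (ginv Gd b) (ginv Gd a).
Proof.
move=> ab; set c := gmul Gd a b.
have sc : src Gd c = src Gd b by rewrite src_gmul.
have rc : rng Gd c = rng Gd a by rewrite rng_gmul.
have h : gmul Gd (gmul Gd (ginv Gd b) (ginv Gd a)) c = \val (src Gd b).
  by rewrite -gmulA ?src_ginv ?rng_ginv // gmulVK // gmulVl.
rewrite -[RHS](gmul_unitr Gd) src_gmul ?src_ginv ?rng_ginv // -rc -gmulV.
by rewrite gmulA ?src_gmul ?rng_ginv ?src_ginv // h -sc -rng_ginv gmul_unitl.
Qed.

(* [back a z] is the translate of [z] by the inverse of [a]; it only matters
   when [rng Gd a = anchor z]. *)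
Record groupoid_action (X : Type) := GroupoidAction {
  anchor : X -> units Gd;
  back : G -> X -> X;
  anchor_back : forall a z, rng Gd a = anchor z -> anchor (back a z) = src Gd a;
  back_unit : forall z, back (\val (anchor z)) z = z;
  back_gmul : forall a b z, src Gd a = rng Gd b -> rng Gd a = anchor z ->
    back (gmul Gd a b) z = back b (back a z)
}.

Lemma back_inv X (act : groupoid_action X) a z : rng Gd a = anchor act z ->
  back act (ginv Gd a) (back act a z) = z.
Proof.
by move=> az; rewrite -back_gmul ?rng_ginv // gmulV az back_unit.
Qed.

(** An arrow [a] carries [src a] to [rng a], so translating back by [a] lands on [src a]; this is
    the action behind l2(units). *)
Definition unit_action : groupoid_action (units Gd).
Proof.
apply: (@GroupoidAction _ id (fun a _ => src Gd a)) => // [x|a b x ab _].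
  exact: src_unit.
by rewrite src_gmul.
Defined.

(** Left translation preserves sources, so its representation on l2(G) is the sum of the left
    regular representations on the fibres of [src]. *)
Definition left_action : groupoid_action G.
Proof.
apply: (@GroupoidAction _ (rng Gd) (fun a b => gmul Gd (ginv Gd a) b)).
- by move=> a b ab; rewrite rng_gmul ?rng_ginv ?src_ginv.
- by move=> b; rewrite ginv_unit gmul_unitl.
- by move=> a b c ab ac; rewrite ginvM // gmulA ?src_ginv ?rng_ginv.
Defined.

Definition bisection (S : set G) : Prop :=
  (forall a b, S a -> S b -> src Gd a = src Gd b -> a = b) /\
  (forall a b, S a -> S b -> rng Gd a = rng Gd b -> a = b).

Lemma bisection_sub S T : S `<=` T -> bisection T -> bisection S.
Proof. by move=> ST [s r]; split=> a b /ST + /ST; [exact: s|exact: r]. Qed.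

End GroupoidBasics.

(** * Convolution and involution of functions supported on bisections *)

Section BisectionFunctions.
Context (R : realType) (G : topologicalType) (Gd : groupoid G).
Local Notation C := (R[i]^o).
Implicit Types (f g : G -> C) (S : set G).

(** [M] bounds the squared modulus, so such an [f] acts with norm at most [sqrt M]. *)
Definition basic_on S (M : R) f : Prop :=
  [/\ bisection Gd S, forall a, ~ S a -> f a = 0 &
      forall a, sqnorm (f a) <= M].

Definition basic f : Prop := exists S M, basic_on S M f.

(* Dropping continuity from [conv_algebra] allows cutting a function along a
   finite cover by bisections, so that no partition of unity is needed. *)
Inductive bfin : (G -> C) -> Prop :=
| bfin0 : bfin 0
| bfin_cons f g : basic f -> bfin g -> bfin (f + g).

Lemma bfin_basic f : basic f -> bfin f.
Proof. by move=> bf; rewrite -[f]addr0; apply: bfin_cons => //; exact: bfin0. Qed.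

Lemma bfinD f g : bfin f -> bfin g -> bfin (f + g).
Proof.
move=> + bg; elim=> [|h k bh bk ih]; first by rewrite add0r.
by rewrite -addrA; exact: bfin_cons.
Qed.

Lemma basicZ (c : C) f : basic f -> basic (c *: f).
Proof.
move=> [S [M [bS f0 fM]]]; exists S, (sqnorm c * M); split=> // a.
  by move=> /f0 fa; rewrite -[LHS]/(c * f a) fa mulr0.
by rewrite -[_ a]/(c * f a) sqnormM ler_wpM2l ?sqnorm_ge0.
Qed.

Lemma bfinZ (c : C) f : bfin f -> bfin (c *: f).
Proof.
elim=> [|h k bh bk ih]; first by rewrite scaler0; exact: bfin0.
by rewrite scalerDr; apply: bfin_cons => //; exact: basicZ.
Qed.

Lemma bfin_sum (I : eqType) (s : seq I) (F : I -> G -> C) :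
  (forall i, i \in s -> bfin (F i)) -> bfin (\sum_(i <- s) F i).
Proof.
elim: s => [|i s ih] h; first by rewrite big_nil; exact: bfin0.
rewrite big_cons; apply: bfinD; first by apply: h; rewrite mem_head.
by apply: ih => j js; apply: h; rewrite inE js orbT.
Qed.

(** A sum over a set is [0] by default when its support is infinite. Finiteness on range fibres
    makes [act_sum] additive, finiteness on source fibres makes [conv] additive. *)
Definition fiber_finite f : Prop := forall x : units Gd,
  finite_set [set a | rng Gd a = x /\ f a != 0] /\
  finite_set [set a | src Gd a = x /\ f a != 0].

Lemma finite_subsingleton (T : Type) (A : set T) :
  (forall a b, A a -> A b -> a = b) -> finite_set A.
Proof.
move=> h; have [[a Aa]|A0] := pselect (A !=set0).
  by apply: (@sub_finite_set _ _ [set a]) => // b Ab; exact: h.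
by rewrite (_ : A = set0) //; apply: contra_notP A0 => /eqP/set0P.
Qed.

Lemma bfin_fiber_finite f : bfin f -> fiber_finite f.
Proof.
elim=> [|{}f g [S [M [[sS rS] f0 _]]] _ ih] x.
  by split; apply: finite_subsingleton => a b []; rewrite /= eqxx.
have [r s] := ih x.
have inS a : f a != 0 -> S a.
  by apply: contraNP => /f0 ->; rewrite eqxx.
split.
  apply: (@sub_finite_set _ _ ([set a | rng Gd a = x /\ f a != 0] `|`
    [set a | rng Gd a = x /\ g a != 0])) => [a [ax fga]|].
    have [fa|fa] := eqVneq (f a) 0; last by left.
    by right; split=> //; move: fga; rewrite -[(f + g) a]/(f a + g a) fa add0r.
  rewrite finite_setU; split=> //.
  by apply: finite_subsingleton => a b [<- /inS fa] [ba /inS fb]; exact: rS.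
apply: (@sub_finite_set _ _ ([set a | src Gd a = x /\ f a != 0] `|`
  [set a | src Gd a = x /\ g a != 0])) => [a [ax fga]|].
  have [fa|fa] := eqVneq (f a) 0; last by left.
  by right; split=> //; move: fga; rewrite -[(f + g) a]/(f a + g a) fa add0r.
rewrite finite_setU; split=> //.
by apply: finite_subsingleton => a b [<- /inS fa] [ba /inS fb]; exact: sS.
Qed.

Lemma fsum_split_supp (T : choiceType) (A : set T) (u v : T -> C) :
  finite_set [set a | A a /\ u a != 0] ->
  finite_set [set a | A a /\ v a != 0] ->
  \sum_(a \in A) (u a + v a) = \sum_(a \in A) u a + \sum_(a \in A) v a.
Proof.
move=> fu fv.
pose B := [set a | A a /\ u a != 0] `|` [set a | A a /\ v a != 0].
have fB : finite_set B by rewrite finite_setU.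
have BA : B `<=` A by move=> a [] [].
have out a : (A `\` B) a -> u a = 0 /\ v a = 0.
  move=> [Aa nB]; split; apply/eqP; apply: contra_notT nB => h.
    by left.
  by right.
rewrite -!(@fsbig_widen _ _ _ _ _ _ _ BA).
- exact: fsbig_split.
- by move=> a /out [].
- by move=> a /out [].
- by move=> a /out [ua va]; rewrite /= ua va addr0.
Qed.

Lemma fsum_single (T : choiceType) (A : set T) (u : T -> C) a0 : A a0 ->
  (forall a, A a -> a <> a0 -> u a = 0) -> \sum_(a \in A) u a = u a0.
Proof.
move=> Aa h; rewrite -(@fsbig_widen _ _ _ _ [set a0]) ?fsbig_set1 //.
  by move=> a ->.
by move=> a [Aa' na]; exact: h.
Qed.

(** In the bisection [S'] only [b] has the source of [gmul a b], so the convolution sum has a single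
    term. *)
Lemma conv_basic_mul S S' M M' f g a b : basic_on S M f -> basic_on S' M' g ->
  S' b -> src Gd a = rng Gd b -> conv Gd f g (gmul Gd a b) = f a * g b.
Proof.
move=> [_ _ _] [[sS' _] g0 _] Sb ab.
rewrite /conv (@fsum_single _ _ _ b) ?gmulKV // => [|c].
  by rewrite /= src_gmul.
rewrite /= src_gmul // => cb ncb; rewrite g0 ?mulr0 // => Sc.
by apply: ncb; exact: sS'.
Qed.

Lemma conv_neq0 f g c : conv Gd f g c != 0 ->
  exists b, [/\ src Gd b = src Gd c, f (gmul Gd c (ginv Gd b)) != 0 & g b != 0].
Proof.
move=> fg; apply: contrapT => n; move: fg.
rewrite /conv fsbig1 ?eqxx // => b bc; apply/eqP; rewrite mulf_eq0.
rewrite -[_ || _]negbK negb_or; apply/negP => /andP[fb gb].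
by apply: n; exists b.
Qed.

Lemma conv_basic_support S S' M M' f g c : basic_on S M f ->
  basic_on S' M' g -> conv Gd f g c != 0 ->
  exists a b, [/\ S a, S' b, src Gd a = rng Gd b & c = gmul Gd a b].
Proof.
move=> [_ f0 _] [_ g0 _] /conv_neq0 [b [bc fb gb]].
exists (gmul Gd c (ginv Gd b)), b; split.
- by apply: contraNP fb => /f0 ->.
- by apply: contraNP gb => /g0 ->.
- by rewrite src_gmul ?src_ginv // rng_ginv.
- by rewrite -gmulA ?src_ginv ?rng_ginv // gmulVl bc gmul_unitr.
Qed.

(** The product set of two bisections is again a bisection: the source of a product determines its
    right factor, hence the left one, and symmetrically for ranges. *)
Lemma conv_basic f g : basic f -> basic g -> basic (conv Gd f g).
Proof.
move=> [S [M fS]] [S' [M' gS]].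
have [[sS rS] f0 fM] := fS; have [[sS' rS'] g0 gM] := gS.
pose T := [set c | exists a b, [/\ S a, S' b, src Gd a = rng Gd b &
  c = gmul Gd a b]].
have out c : ~ T c -> conv Gd f g c = 0.
  by move=> nc; apply: contra_notP nc => /eqP; exact: conv_basic_support.
exists T, (M * M'); split=> //.
- split=> _ _ [a [b [Sa Sb ab ->]]] [a' [b' [Sa' Sb' ab' ->]]].
    rewrite !src_gmul // => e; have bb := sS' _ _ Sb Sb' e.
    by rewrite (sS a a') // ?bb // ab bb.
  rewrite !rng_gmul // => e; have aa := rS _ _ Sa Sa' e.
  by rewrite (rS' b b') // ?aa // -ab aa.
- move=> c; have [[a [b [Sa Sb ab ->]]]|/out ->] := pselect (T c).
    by rewrite (conv_basic_mul fS gS) // sqnormM ler_pM ?sqnorm_ge0.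
  rewrite (_ : sqnorm 0 = 0); last by apply/eqP; rewrite sqnorm_eq0.
  by rewrite mulr_ge0 // (le_trans (sqnorm_ge0 _) (fM c), le_trans (sqnorm_ge0 _) (gM c)).
Qed.


Lemma convDl f1 f2 g : fiber_finite g ->
  conv Gd (f1 + f2) g = conv Gd f1 g + conv Gd f2 g.
Proof.
move=> fg; apply/funext => c; rewrite -[RHS]/(conv Gd f1 g c + conv Gd f2 g c).
have [_ fs] := fg (src Gd c).
rewrite -fsum_split_supp.
- by apply: eq_fsbigr => b _; rewrite -mulrDl.
- apply: sub_finite_set fs => b /= [bc]; rewrite mulf_eq0 negb_or.
  by move=> /andP[_ ->].
- apply: sub_finite_set fs => b /= [bc]; rewrite mulf_eq0 negb_or.
  by move=> /andP[_ ->].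
Qed.

Lemma convDr f g1 g2 : fiber_finite g1 -> fiber_finite g2 ->
  conv Gd f (g1 + g2) = conv Gd f g1 + conv Gd f g2.
Proof.
move=> fg1 fg2; apply/funext => c.
rewrite -[RHS]/(conv Gd f g1 c + conv Gd f g2 c).
have [_ fs1] := fg1 (src Gd c); have [_ fs2] := fg2 (src Gd c).
rewrite -fsum_split_supp.
- by apply: eq_fsbigr => b _; rewrite -mulrDr.
- apply: sub_finite_set fs1 => b /= [bc]; rewrite mulf_eq0 negb_or.
  by move=> /andP[_ ->].
- apply: sub_finite_set fs2 => b /= [bc]; rewrite mulf_eq0 negb_or.
  by move=> /andP[_ ->].
Qed.

Lemma conv0l g : conv Gd 0 g = 0.
Proof. by apply/funext => c; apply: fsbig1 => b _; rewrite mul0r. Qed.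

Lemma conv0r f : conv Gd f 0 = 0.
Proof. by apply/funext => c; apply: fsbig1 => b _; rewrite mulr0. Qed.

Lemma bfin_conv f g : bfin f -> bfin g -> bfin (conv Gd f g).
Proof.
move=> + bg; elim=> [|{}f h bf bh ih]; first by rewrite conv0l; exact: bfin0.
rewrite convDl; last exact: bfin_fiber_finite.
apply: bfinD => //; elim: bg => [|{ih h bh}g k bg bk ih].
  by rewrite conv0r; exact: bfin0.
rewrite convDr; [|exact/bfin_fiber_finite/bfin_basic|exact: bfin_fiber_finite].
by apply: bfin_cons => //; exact: conv_basic.
Qed.

Lemma starD f g : star Gd (f + g) = star Gd f + star Gd g.
Proof. by apply/funext => a; exact: rmorphD. Qed.

Lemma star0 : star Gd (0 : G -> C) = 0.
Proof. by apply/funext => a; rewrite /star rmorph0. Qed.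

Lemma star_basic_on S M f : basic_on S M f ->
  basic_on [set a | S (ginv Gd a)] M (star Gd f).
Proof.
move=> [[sS rS] f0 fM]; split.
- split=> a b Sa Sb e; rewrite -[a](ginvK Gd) -[b](ginvK Gd); congr ginv.
    by apply: rS => //; rewrite !rng_ginv.
  by apply: sS => //; rewrite !src_ginv.
- by move=> a /f0; rewrite /star => ->; rewrite rmorph0.
- move=> a; apply: le_trans (fM (ginv Gd a)); rewrite /star.
  by case: (f (ginv Gd a)) => x y; rewrite /sqnorm /= sqrrN.
Qed.

Lemma bfin_star f : bfin f -> bfin (star Gd f).
Proof.
elim=> [|{}f g [S [M bf]] bg ih]; first by rewrite star0; exact: bfin0.
by rewrite starD; apply: bfin_cons => //; exists [set a | S (ginv Gd a)], M;
  exact: star_basic_on.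
Qed.

End BisectionFunctions.

(** * The representation on square-summable families of an action *)

Lemma hnorm0 (R : realType) (H : hilbert R) : hnorm (0 : H) = 0.
Proof. by apply/eqP; rewrite hnorm_eq0. Qed.

Section L2Values.
Context (R : realType) (X : choiceType).
Implicit Types u v : l2 R X.

Lemma l2_valD u v : \val (u + v) = \val u + \val v.
Proof. exact: raddfD. Qed.

Lemma l2_valZ (c : R[i]) u : \val (c *: u) = c *: \val u.
Proof. exact: linearZ. Qed.

End L2Values.

Section ActionRepresentation.
Context (R : realType) (G : topologicalType) (Gd : groupoid G).
Context (X : choiceType) (act : groupoid_action Gd X).
Local Notation C := (R[i]^o).
Local Notation anchor := (anchor act).
Local Notation back := (back act).
Implicit Types (f g : G -> C) (S : set G) (xi eta : X -> C).

(** For [left_action] this is convolution by [f]; for [unit_action] it moves the point mass at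
    [src a] to [rng a] with weight [f a]. *)
Definition act_sum f xi : X -> C := fun z =>
  \sum_(a \in [set a | rng Gd a = anchor z]) f a * xi (back a z).

Lemma act_sumDl f g xi : fiber_finite Gd f -> fiber_finite Gd g ->
  act_sum (f + g) xi = act_sum f xi + act_sum g xi.
Proof.
move=> ff fg; apply/funext => z.
rewrite -[RHS]/(act_sum f xi z + act_sum g xi z).
have [fs _] := ff (anchor z); have [gs _] := fg (anchor z).
rewrite -fsum_split_supp.
- by apply: eq_fsbigr => b _; rewrite -mulrDl.
- apply: sub_finite_set fs => b /= [bc]; rewrite mulf_eq0 negb_or.
  by move=> /andP[->].
- apply: sub_finite_set gs => b /= [bc]; rewrite mulf_eq0 negb_or.
  by move=> /andP[->].
Qed.

Lemma act_sum0l xi : act_sum 0 xi = 0.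
Proof. by apply/funext => z; apply: fsbig1 => b _; rewrite mul0r. Qed.

Lemma act_sumZl (c : C) f xi : act_sum (c *: f) xi = c *: act_sum f xi.
Proof.
apply/funext => z; rewrite -[RHS]/(c * act_sum f xi z) mulr_fsumr.
by apply: eq_fsbigr => b _; rewrite mulrA.
Qed.

Lemma act_sum_linear f : fiber_finite Gd f -> linear (act_sum f).
Proof.
move=> ff c xi eta; apply/funext => z.
rewrite -[RHS]/(c * act_sum f xi z + act_sum f eta z) mulr_fsumr.
have [fs _] := ff (anchor z).
rewrite -fsum_split_supp.
- apply: eq_fsbigr => b _; rewrite mulrCA -mulrDr.
  by [].
- apply: sub_finite_set fs => b /= [bc]; rewrite !mulf_eq0 !negb_or.
  by move=> /and3P[_ ->].
- apply: sub_finite_set fs => b /= [bc]; rewrite mulf_eq0 negb_or.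
  by move=> /andP[->].
Qed.

Section OneBisection.
Context (S : set G) (M : R) (f : G -> C).
Hypothesis fS : basic_on Gd S M f.

(** The bisection [S] defines a partial injection [tau] of [X] with domain [D]: [ga z] is the unique
    arrow of [S] ending at [anchor z], and a unit by default outside [D]. *)
Let D := [set z | exists a, S a /\ rng Gd a = anchor z].

Let ga z := xget (\val (anchor z)) [set a | S a /\ rng Gd a = anchor z].

Let gaP z : D z -> S (ga z) /\ rng Gd (ga z) = anchor z.
Proof. by move=> Dz; exact: (xgetPex _ Dz). Qed.

Let tau z := back (ga z) z.

Lemma act_sum_basic xi a z : S a -> rng Gd a = anchor z ->
  act_sum f xi z = f a * xi (back a z).
Proof.
have [[_ rS] f0 _] := fS; move=> Sa az.
rewrite /act_sum (@fsum_single _ _ _ _ a) // => b bz ba.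
have [Sb|/f0 ->] := pselect (S b); last by rewrite mul0r.
by exfalso; apply: ba; apply: rS => //; rewrite bz.
Qed.

Let act_sum_out xi z : ~ D z -> act_sum f xi z = 0.
Proof.
have [_ f0 _] := fS; move=> nD; apply: fsbig1 => a az.
have [Sa|/f0 ->] := pselect (S a); last by rewrite mul0r.
by exfalso; apply: nD; exists a.
Qed.

(** The anchor of [tau z] is the source of [ga z], which determines [ga z] within [S]; translating
    forward again recovers [z]. *)
Let tau_inj : set_inj D tau.
Proof.
have [[sS _] _ _] := fS.
move=> z z' /set_mem/gaP[Sz gz] /set_mem/gaP[Sz' gz'] e.
have ee : ga z = ga z'.
  by apply: sS => //; rewrite -(anchor_back gz) -(anchor_back gz') -/(tau z) e.
by rewrite -(back_inv gz) -(back_inv gz') -/(tau z) -/(tau z') e ee.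
Qed.

(** [f] acts as composition with [tau] followed by a weight, so injectivity of [tau] compares the
    left side with a sum over a part of [X]. *)
Lemma act_sum_basic_sqnorm xi :
  (\esum_(z in [set: X]) (sqnorm (act_sum f xi z))%:E <=
   \esum_(z in [set: X]) (M * sqnorm (xi z))%:E)%E.
Proof.
have [_ _ fM] := fS.
(* The sign of [M] comes from a value of [f]; a point of [X] provides an element of [G] through its
   anchor. *)
have M0 (z : X) : 0 <= M.
  exact: le_trans (sqnorm_ge0 _) (fM (\val (anchor z))).
apply: (@le_trans _ _ (\esum_(z in D) (M * sqnorm (xi (tau z)))%:E)%E).
  rewrite [leRHS]esum_mkcond; apply: le_esum => z _; case: ifPn.
    move=> /set_mem Dz; have [Sz gz] := gaP Dz.
    by rewrite (act_sum_basic xi Sz gz) sqnormM lee_fin ler_wpM2r ?sqnorm_ge0.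
  rewrite notin_setE => /act_sum_out ->.
  by rewrite lee_fin (_ : sqnorm 0 = 0) //; apply/eqP; rewrite sqnorm_eq0.
rewrite -(@esum_image _ _ _ _ _ (fun w => (M * sqnorm (xi w))%:E)) //.
rewrite esum_mkcond; apply: le_esum => z _; case: ifP => // _.
by rewrite lee_fin mulr_ge0 ?sqnorm_ge0 ?(M0 z).
Qed.

(** The adjoint of a weighted partial injection is the inverse injection with conjugate weights: the
    right-hand sum is reindexed along [tau]. *)
Lemma csum_star_basic xi eta :
  csum (fun z => act_sum (star Gd f) xi z * Num.conj (eta z)) =
  csum (fun z => xi z * Num.conj (act_sum f eta z)).
Proof.
have fS' := star_basic_on fS.
have [[sS rS] f0 _] := fS; symmetry.
apply: (csum_reindex tau_inj) => [z /act_sum_out -> |w nw|z Dz].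
- by rewrite rmorph0 mulr0.
- rewrite [act_sum _ _ _]fsbig1 ?mul0r // => a /= aw.
  have [Sa|na] := pselect (S (ginv Gd a)); last first.
    by rewrite /star f0 // rmorph0 mul0r.
  exfalso; apply: nw; exists (back a w).
    by exists (ginv Gd a); split; rewrite // rng_ginv anchor_back.
  have Dz : D (back a w).
    by exists (ginv Gd a); split; rewrite // rng_ginv anchor_back.
  have [Sz gz] := gaP Dz; rewrite /tau.
  have -> : ga (back a w) = ginv Gd a.
    by apply: rS => //; rewrite gz rng_ginv anchor_back.
  exact: back_inv.
- have [Sz gz] := gaP Dz; rewrite (act_sum_basic eta Sz gz).
  have Sz' : S (ginv Gd (ginv Gd (ga z))) by rewrite ginvK.
  rewrite [act_sum _ _ _](@fsum_single _ _ _ _ (ginv Gd (ga z))).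
  + by rewrite back_inv // /star ginvK rmorphM mulrA [xi z * _]mulrC.
  + by rewrite /= rng_ginv -(anchor_back gz).
  + move=> a /= aw na; have [Sa|nSa] := pselect (S (ginv Gd a)); last first.
      by rewrite /star f0 // rmorph0 mul0r.
    exfalso; apply: na; rewrite -[a](ginvK Gd); congr ginv; apply: sS => //.
    by rewrite src_ginv aw (anchor_back gz).
Qed.

End OneBisection.

(** At each point at most one composable pair of arrows contributes; if either arrow is missing,
    both sides vanish. *)
Lemma act_sum_conv_basic f g xi : basic Gd f -> basic Gd g ->
  act_sum (conv Gd f g) xi = act_sum f (act_sum g xi).
Proof.
move=> [S [M fS]] [S' [M' gS]]; apply/funext => z.
have [[sS rS] f0 _] := fS; have [[sS' rS'] g0 _] := gS.
have supp := conv_basic_support fS gS.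
have [[a [Sa az]]|nz] := pselect (exists a, S a /\ rng Gd a = anchor z).
  rewrite (act_sum_basic fS _ Sa az).
  have [[b [Sb ba]]|nb] := pselect (exists b, S' b /\ rng Gd b = src Gd a).
    rewrite (act_sum_basic gS _ Sb); last by rewrite anchor_back.
    rewrite [LHS](@fsum_single _ _ _ _ (gmul Gd a b)).
    + by rewrite (conv_basic_mul fS gS) // back_gmul // mulrA.
    + by rewrite /= rng_gmul.
    + move=> c /= cz ncab; apply/eqP; rewrite mulf_eq0; apply/orP; left.
      apply/negPn/negP => /(supp _) [a' [b' [Sa' Sb' ab' cE]]]; apply: ncab.
      have aa : a' = a by apply: rS => //; rewrite az -cz cE rng_gmul.
      by rewrite cE aa (rS' b' b) // -ab' aa.
  rewrite [act_sum g _ _]fsbig1 ?mulr0; last first.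
    move=> b /= bz; have [Sb|/g0 ->] := pselect (S' b); last by rewrite mul0r.
    by exfalso; apply: nb; exists b; rewrite bz anchor_back.
  apply: fsbig1 => c /= cz; apply/eqP; rewrite mulf_eq0; apply/orP; left.
  apply/negPn/negP => /(supp _) [a' [b' [Sa' Sb' ab' cE]]]; apply: nb.
  exists b'; split=> //; rewrite -ab'; congr src.
  by apply: rS => //; rewrite az -cz cE rng_gmul.
rewrite [RHS]fsbig1; last first.
  move=> a /= az; have [Sa|/f0 ->] := pselect (S a); last by rewrite mul0r.
  by exfalso; apply: nz; exists a.
apply: fsbig1 => c /= cz; apply/eqP; rewrite mulf_eq0; apply/orP; left.
apply/negPn/negP => /(supp _) [a' [b' [Sa' Sb' ab' cE]]]; apply: nz.
by exists a'; split=> //; rewrite -cz cE rng_gmul.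
Qed.

Lemma act_sum_conv f g xi : bfin Gd f -> bfin Gd g ->
  act_sum (conv Gd f g) xi = act_sum f (act_sum g xi).
Proof.
move=> + bg; elim=> [|{}f h bf bh ih]; first by rewrite conv0l !act_sum0l.
have bf' := bfin_basic bf.
rewrite convDl; last exact: bfin_fiber_finite.
rewrite !act_sumDl ?ih; try by do ?[apply: bfin_conv|apply: bfin_fiber_finite].
congr (_ + _); elim: bg => [|{ih h bh}g k bg bk ih].
  rewrite conv0r !act_sum0l; apply/esym/funext => z.
  by apply: fsbig1 => a _; rewrite mulr0.
have bg' := bfin_basic bg.
rewrite convDr; try exact: bfin_fiber_finite.
rewrite !act_sumDl ?ih ?act_sum_conv_basic //;
  try by do ?[apply: bfin_conv|apply: bfin_fiber_finite].
have /(_ 1 (act_sum g xi) (act_sum k xi)) :=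
  act_sum_linear (bfin_fiber_finite bf').
by rewrite !scale1r => ->.
Qed.

Lemma act_sum_l2 f (xi : l2 R X) : bfin Gd f ->
  act_sum f (\val xi) \in @l2_pred R X.
Proof.
elim=> [|{}f g bf bg ih]; first by rewrite act_sum0l rpred0.
rewrite act_sumDl; try exact: bfin_fiber_finite (bfin_basic bf);
  try exact: bfin_fiber_finite bg.
apply: rpredD => //; have [S [M fS]] := bf; apply/asboolP.
apply: le_lt_trans (rsummableZ M (l2P xi)).
apply: (@le_trans _ _ (\esum_(z in [set: X])
    (sqnorm (act_sum f (\val xi) z))%:E)%E).
  by apply: le_esum => z _; rewrite ger0_norm ?sqnorm_ge0.
apply: le_trans (act_sum_basic_sqnorm fS _) _.
by apply: le_esum => z _; rewrite lee_fin ler_norm.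
Qed.

(** The default [0] concerns sums that are not square-summable, which [act_sum_l2] excludes for
    [bfin] functions. *)
Definition act_op f (xi : l2_hilbert R X) : l2_hilbert R X :=
  insubd (0 : l2 R X) (act_sum f (\val (xi : l2 R X))).

Lemma act_opE f (xi : l2 R X) : bfin Gd f ->
  \val (act_op f xi : l2 R X) = act_sum f (\val xi).
Proof. by move=> bf; rewrite val_insubd act_sum_l2. Qed.

Lemma act_op_basic_bound S M f (xi : l2_hilbert R X) : 0 <= M ->
  basic_on Gd S M f -> hnorm (act_op f xi) <= Num.sqrt M * hnorm xi.
Proof.
move=> M0 fS; rewrite [leLHS]l2_normE [hnorm xi]l2_normE -sqrtrM //.
have bf : bfin Gd f by apply: bfin_basic; exists S, M.
have sq0 (u : l2 R X) z : 0 <= sqnorm (\val u z) by exact: sqnorm_ge0.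
have M0' z : 0 <= M * sqnorm (\val (xi : l2 R X) z) by rewrite mulr_ge0.
apply: ler_wsqrtr; rewrite -(psumZ M0 (sq0 _) (l2P _)) -lee_fin.
rewrite -(rsummable_psum (sq0 _) (l2P _)).
rewrite -(rsummable_psum M0' (rsummableZ _ (l2P _))).
rewrite act_opE //; exact: act_sum_basic_sqnorm fS _.
Qed.

Lemma act_opD f g (u : l2_hilbert R X) : bfin Gd f -> bfin Gd g ->
  act_op (f + g) u = act_op f u + act_op g u.
Proof.
move=> bf bg; apply: (@val_inj _ _ (l2 R X)); apply: etrans (esym (l2_valD _ _)).
rewrite !act_opE //; last exact: bfinD.
by rewrite act_sumDl //; exact: bfin_fiber_finite.
Qed.

Lemma act_op0 (u : l2_hilbert R X) : act_op 0 u = 0.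
Proof.
apply: (@val_inj _ _ (l2 R X)).
by rewrite act_opE ?act_sum0l // ; exact: bfin0.
Qed.

Lemma act_op_bounded f : bfin Gd f -> exists2 K : R, 0 <= K &
  forall u : l2_hilbert R X, hnorm (act_op f u) <= K * hnorm u.
Proof.
elim=> [|{}f g bf bg [K K0 ih]].
  by exists 0 => // u; rewrite mul0r act_op0 hnorm0.
have bf' := bfin_basic bf; have [S [M [bS f0 fM]]] := bf.
exists (Num.sqrt `|M| + K) => [|u]; first by rewrite addr_ge0 ?sqrtr_ge0.
rewrite act_opD //; apply: le_trans (hnorm_add _ _) _; rewrite mulrDl lerD //.
apply: (@act_op_basic_bound S) => //; split=> // a.
exact: le_trans (fM a) (ler_norm M).
Qed.

Lemma act_op_linear f : bfin Gd f -> linear (act_op f).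
Proof.
move=> bf c u v; apply: (@val_inj _ _ (l2 R X)).
apply: etrans (esym (l2_valD _ _)); rewrite l2_valZ.
rewrite !act_opE // -(act_sum_linear (bfin_fiber_finite bf)).
by rewrite -l2_valZ -l2_valD.
Qed.

Lemma act_op_star f (u v : l2_hilbert R X) : bfin Gd f ->
  hdot (l2_hilbert R X) (act_op (star Gd f) u) v =
  hdot (l2_hilbert R X) u (act_op f v).
Proof.
elim=> [|{}f g bf bg ih].
  by rewrite star0 !act_op0 linear0l linear0r.
have bf' := bfin_basic bf.
rewrite starD !act_opD //; try exact: bfin_star.
rewrite linearDl linearDr; congr (_ + _); last exact: ih.
have [S [M fS]] := bf.
transitivity (csum (fun z => act_sum (star Gd f) (\val (u : l2 R X)) z *
    Num.conj (\val (v : l2 R X) z))).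
  by rewrite -act_opE //; exact: bfin_star.
by rewrite (csum_star_basic fS) -act_opE.
Qed.

Lemma act_op_star_representation :
  (forall f, conv_algebra f -> bfin Gd f) ->
  star_representation Gd act_op.
Proof.
move=> cb; split.
- move=> f /cb bf; split; first exact: act_op_linear.
  by have [K _ hK] := act_op_bounded bf; exists K.
- move=> c f g u /cb bf /cb bg; rewrite act_opD //; last exact: bfinZ.
  congr (_ + _); apply: (@val_inj _ _ (l2 R X)).
  apply: etrans (esym (l2_valZ _ _)).
  by rewrite !act_opE ?act_sumZl //; exact: bfinZ.
- move=> f g u /cb bf /cb bg; apply: (@val_inj _ _ (l2 R X)).
  by rewrite !act_opE ?act_sum_conv //; exact: bfin_conv.
- by move=> f u v /cb; exact: act_op_star.
Qed.

End ActionRepresentation.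

(** * Etale topology *)

Section ComplexContinuity.
Context (R : realType).
Local Notation C := (R[i]^o).

Lemma sqnorm0 : sqnorm (0 : C) = 0.
Proof. by apply/eqP; rewrite sqnorm_eq0. Qed.

Lemma normC_sqnorm (z : C) : `|z| = (Num.sqrt (sqnorm z))%:C%C.
Proof. by rewrite [LHS]normc_def. Qed.

Lemma normC_lt (z : C) (e : R) : 0 < e ->
  (`|z| < e%:C%C) = (sqnorm z < e ^+ 2).
Proof.
move=> e0; rewrite normC_sqnorm ltcR -[in LHS](gtr0_norm e0) -sqrtr_sqr.
by rewrite ltr_sqrt // exprn_gt0.
Qed.

Lemma complex_gt0 (e : R[i]) : 0 < e ->
  0 < complex.Re e /\ e = (complex.Re e)%:C%C.
Proof. by case: e => x y; rewrite ltcE /= => /andP[/eqP -> ->]. Qed.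

Lemma sqnorm_real (r : R) : sqnorm (r%:C%C : C) = r ^+ 2.
Proof. by rewrite /sqnorm /= expr0n addr0. Qed.

Lemma Re_continuous : continuous (fun z : C => complex.Re z).
Proof.
move=> z; apply/(@cvgrPdist_lt _ R^o _ _ (@nbhs_filter C z)) => e e0.
have e1 : 0 < e%:C%C :> R[i] by rewrite ltcR.
have /cvgr_dist_lt /(_ _ e1) : id w @[w --> z] --> (z : C) by exact: cvg_id.
apply: filterS => w /=; rewrite normC_lt //.
have -> : complex.Re z - complex.Re w = complex.Re (z - w) by case: z w => ? ? [].
move=> h; rewrite -(ltr_pXn2r (_ : 0 < 2)%N) ?nnegrE ?(ltW e0) //.
rewrite real_normK ?num_real //; apply: le_lt_trans h.
by rewrite lerDl sqr_ge0.
Qed.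

Lemma Im_continuous : continuous (fun z : C => complex.Im z).
Proof.
move=> z; apply/(@cvgrPdist_lt _ R^o _ _ (@nbhs_filter C z)) => e e0.
have e1 : 0 < e%:C%C :> R[i] by rewrite ltcR.
have /cvgr_dist_lt /(_ _ e1) : id w @[w --> z] --> (z : C) by exact: cvg_id.
apply: filterS => w /=; rewrite normC_lt //.
have -> : complex.Im z - complex.Im w = complex.Im (z - w) by case: z w => ? ? [].
move=> h; rewrite -(ltr_pXn2r (_ : 0 < 2)%N) ?nnegrE ?(ltW e0) //.
rewrite real_normK ?num_real //; apply: le_lt_trans h.
by rewrite lerDr sqr_ge0.
Qed.

Lemma sqnorm_continuous : continuous (fun z : C => sqnorm z).
Proof.
move=> z; rewrite /continuous_at /sqnorm !expr2.
have r : complex.Re w @[w --> z] --> complex.Re z by exact: Re_continuous.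
have i : complex.Im w @[w --> z] --> complex.Im z by exact: Im_continuous.
have F := @nbhs_filter C z.
exact: (cvgD (cvgM r r) (cvgM i i)).
Qed.

Lemma realC_continuous : continuous (fun r : R => r%:C%C : C).
Proof.
move=> r; apply/cvgrPdist_lt => e /complex_gt0 [e1 ->].
have /cvgr_dist_lt /(_ _ e1) : id s @[s --> r] --> r by exact: cvg_id.
apply: filterS => s /=; rewrite -rmorphB normC_lt // sqnorm_real.
by rewrite -real_normK ?num_real // ltr_pXn2r ?nnegrE // ltW.
Qed.

Lemma conjC_continuous : continuous (fun z : C => Num.conj z : C).
Proof.
move=> z; apply/(@cvgrPdist_lt _ C _ _ (@nbhs_filter C z)) => e e0.
have /cvgr_dist_lt /(_ _ e0) : id w @[w --> z] --> (z : C) by exact: cvg_id.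
by apply: filterS => w /=; rewrite -rmorphB norm_conjC.
Qed.

End ComplexContinuity.

Lemma compact_finite_cover (X : topologicalType) (K : set X)
    (P : set X -> Prop) : compact K ->
  (forall x, K x -> exists B, [/\ open B, B x & P B]) ->
  exists2 r : seq (set X), (forall B, B \in r -> P B) &
    forall x, K x -> exists2 B, B \in r & B x.
Proof.
move=> /compact_near_coveringP cK cov.
(* The filter of all sufficiently large finite lists: near each point of [K], being covered by the
   list holds eventually along it. *)
pose F : set_system (seq (set X)) :=
  [set A : set (seq (set X)) |
  exists r0 : seq (set X), forall r : seq (set X), {subset r0 <= r} -> A r].
have FF : Filter F.
  split; first by exists [::].
  - move=> A B [r hA] [t hB]; exists (r ++ t) => q qs; split.
      by apply: hA => x xr; apply: qs; rewrite mem_cat xr.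
    by apply: hB => x xr; apply: qs; rewrite mem_cat xr orbT.
  - by move=> A B AB [r hA]; exists r => q /hA /AB.
have [r0 h0] : F [set r : seq (set X) | K `<=` [set x | exists B, [/\ B \in r, P B & B x]]].
  have := cK (seq (set X)) F
    (fun r x => exists B : set X, [/\ B \in r, P B & B x]) FF.
  apply=> x /cov [B [oB Bx PB]].
  exists (B, [set r : seq (set X) | B \in r]) => /=.
    split; first exact: open_nbhs_nbhs.
    by exists [:: B] => r; apply; rewrite mem_head.
  by move=> [y r] /= [By Br]; exists B.
exists [seq B <- r0 | `[< P B >]] => [B|x /(h0 r0 (fun=> id))].
  by rewrite mem_filter => /andP[/asboolP].
move=> [B [Br PB Bx]]; exists B => //; rewrite mem_filter Br andbT.
exact/asboolP.
Qed.

Section EtaleTopology.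
Context (R : realType) (G : topologicalType) (Gd : groupoid G).
Hypothesis etG : etale_groupoid Gd.
Local Notation C := (R[i]^o).

Lemma etale_chart a : exists U : set G, [/\ open U, U a, open (src Gd @` U),
  (forall b c, U b -> U c -> src Gd b = src Gd c -> b = c) &
  exists g : units Gd -> G, (forall z, U z -> g (src Gd z) = z) /\
    {within src Gd @` U, continuous g}].
Proof.
have [_ _ _ lh] := etG; have [U [oU Ua osU _ [g [gK cg]]]] := lh a.
exists U; split=> //; last by exists g.
by move=> b c Ub Uc e; rewrite -(gK b) // -(gK c) // e.
Qed.

Lemma src_continuous : continuous (src Gd).
Proof.
have [_ _ _ lh] := etG => a; have [U [oU Ua _ cs _]] := lh a.
by move: cs; rewrite continuous_open_subspace // => /(_ a); apply; rewrite inE.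
Qed.

Lemma val_units_continuous : continuous (fun x : units Gd => \val x).
Proof. exact: initial_continuous. Qed.

Lemma ginv_continuous : continuous (ginv Gd).
Proof. by have [[_ ?] _ _ _] := etG. Qed.

Lemma unitsP a : units Gd a <-> \val (src Gd a) = a.
Proof.
split=> [ua|<-]; last exact: set_valP.
have := src_unit (SigSub (mem_set ua) : units Gd).
by move=> /(congr1 val) /= ->.
Qed.

(** Near a unit both [a] and [src a] lie in one chart; having the same source they coincide, so [a]
    is a unit. *)
Lemma units_open : open (units Gd).
Proof.
rewrite openE => x ux; have [U [oU Ux _ sU _]] := etale_chart x.
have cvs : continuous (fun a => \val (src Gd a)).
  by move=> a; apply: continuous_comp; [exact: src_continuous
                                       |exact: val_units_continuous].
have oV : open (U `&` (fun a => \val (src Gd a)) @^-1` U).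
  by apply: openI => //; apply: open_comp => // a _; exact: cvs.
apply: (filterS _ (open_nbhs_nbhs (conj oV _))) => [a [Ua Usa]|].
  by apply/unitsP; apply: sU => //; rewrite src_unit.
by split=> //=; rewrite (unitsP x).1.
Qed.

(** Ranges are sources of inverses, so a chart at [ginv a] supplies injectivity of [rng]. *)
Lemma bisection_nbhs a : exists B : set G, [/\ open B, B a & bisection Gd B].
Proof.
have [U [oU Ua _ sU _]] := etale_chart a.
have [V [oV Va _ sV _]] := etale_chart (ginv Gd a).
exists (U `&` ginv Gd @^-1` V); split=> //.
  by apply: openI => //; apply: open_comp => // b _; exact: ginv_continuous.
split=> b c [Ub Vb] [Uc Vc] e; first exact: sU.
by rewrite -[b](ginvK Gd) -[c](ginvK Gd); congr ginv; apply: sV; rewrite ?src_ginv.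
Qed.

Lemma bfin_cover (r : seq (set G)) (f : G -> C) :
  (forall B, B \in r -> bisection Gd B /\
    exists M, forall b, B b -> sqnorm (f b) <= M) ->
  (forall a, f a != 0 -> exists2 B, B \in r & B a) -> bfin Gd f.
Proof.
elim: r f => [|B r ih] f gd cov.
  rewrite (_ : f = 0); first exact: bfin0.
  by apply/funext => a; apply/eqP/negPn/negP => /cov [].
pose f1 : G -> C := fun a => if a \in B then f a else 0.
pose f2 : G -> C := fun a => if a \in B then 0 else f a.
have -> : f = f1 + f2.
  apply/funext => a; rewrite -[RHS]/(f1 a + f2 a) /f1 /f2.
  by case: ifP; rewrite ?addr0 ?add0r.
apply: bfin_cons.
  have [bB [M hM]] := gd B (mem_head _ _).
  exists B, `|M|; split=> // a; rewrite /f1.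
    by move=> nB; rewrite ifF //; apply/negP => /set_mem.
  case: ifPn => [/set_mem Ba|_]; last by rewrite sqnorm0.
  exact: le_trans (hM a Ba) (ler_norm M).
apply: ih => [B' B'r|a].
  have [|bB' [M hM]] := gd B'; first by rewrite inE B'r orbT.
  split=> //; exists `|M| => b B'b; rewrite /f2; case: ifP => _.
    by rewrite sqnorm0.
  exact: le_trans (hM b B'b) (ler_norm M).
rewrite /f2; case: ifPn => [|aB fa]; first by rewrite eqxx.
have [B' + B'a] := cov a fa; rewrite inE => /orP[/eqP BB|B'r]; last by exists B'.
by move: aB; rewrite notin_setE -BB.
Qed.

Lemma elementary_bfin (f : G -> C) : elementary f -> bfin Gd f.
Proof.
move=> [U [oU _ [fU cf cK]]].
set K := U `&` _ in cK.
have [||r r_good Kcov] := @compact_finite_cover _ K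
    (fun B => bisection Gd B /\ exists M, forall b, B b -> sqnorm (f b) <= M).
- exact: cK.
- move=> a [Ua _]; have [B [oB Ba bB]] := bisection_nbhs a.
  move: cf; rewrite continuous_open_subspace // => /(_ a).
  rewrite inE => /(_ Ua) /cvgr_dist_lt /(_ 1 ltr01) /nbhs_interior near1.
  exists (B `&` [set t | `|f a - f t| < 1]°); split.
  + by apply: openI => //; exact: open_interior.
  + by split=> //; exact: nbhs_singleton near1.
  split; first by apply: bisection_sub bB => b [].
  (* The set consists of points where [f] is within [1] of [f a]; the constant is that of
     [sqnormD_le] for [f b = (f b - f a) + f a]. *)
  exists (2 * 1 + 2 * sqnorm (f a)) => b [_ /interior_subset /= hb].
  rewrite -[f b](subrK (f a)); apply: le_trans (sqnormD_le _ _) _.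
  rewrite lerD2r ler_wpM2l // -[X in _ <= X](expr1n _ 2) ltW // -normC_lt //.
  by rewrite distrC.
- apply: (bfin_cover r_good) => a fa.
  apply: Kcov; split; last exact: subset_closure.
  by apply: contrapT => /fU fa0; rewrite fa0 eqxx in fa.
Qed.

Lemma conv_algebra_bfin (f : G -> C) : conv_algebra f -> bfin Gd f.
Proof.
move=> [s [hs ->]]; apply: bfin_sum => p /hs /elementary_bfin.
exact: bfinZ.
Qed.

(** Transports [h] from the units to [B] along the section [g] of the source map. It serves both for
    a bisection and, with [g] the inclusion, for the unit space. *)
Lemma Cc_pullback (B : set G) (K : set (units Gd)) (h : units Gd -> R)
    (g : units Gd -> G) (f : G -> C) : open B -> continuous h ->
  compact K -> closed K -> (forall x, h x != 0 -> K x) ->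
  {within K, continuous g} -> (forall x, K x -> B (g x)) ->
  (forall b, B b -> g (src Gd b) = b) ->
  (forall a, ~ B a -> f a = 0) -> (forall a, B a -> f a = (h (src Gd a))%:C%C) ->
  Cc B f.
Proof.
move=> oB ch cK clK hK cg Bg gK f0 fB; split=> //.
  apply: (@subspace_eq_continuous _ _ _ (fun a => (h (src Gd a))%:C%C : C)).
    by move=> a; rewrite inE => Ba; rewrite /from_subspace fB.
  apply: continuous_subspaceT => a.
  have chs : {for a, continuous (fun a => h (src Gd a))}.
    by apply: continuous_comp; [exact: src_continuous|exact: ch].
  by apply: (continuous_comp chs); exact: realC_continuous.
(* The image of [K] is compact but, without Hausdorffness of [G], possibly not closed; intersecting
   it with the closed support stays compact. *)
rewrite (_ : B `&` _ = g @` K `&` closure [set a | f a != 0]).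
  by apply: compact_closedI; [exact: continuous_compact|exact: closed_closure].
apply/seteqP; split=> [b [Bb cb]|_ [[k Kk <-] cb]]; split=> //; last exact: Bg.
exists (src Gd b); last exact: gK.
(* Points of the support near [b] have their source in [K], so the source of [b] is in the closure
   of [K]. *)
apply: clK => N Nb; have [c [fc Nc]] := cb _ (src_continuous Nb).
exists (src Gd c); split=> //; apply: hK.
have Bc : B c by apply: contrapT => /f0 e; move: fc; rewrite /= e eqxx.
move: fc; rewrite /= fB //; apply: contra => /eqP ->.
by [].
Qed.

End EtaleTopology.

(** Regularity gives a neighbourhood [N] of [x0] with closure inside [W] and a compact set. The
    Urysohn function [u] is [0] at [x0] and [1] off the interior of [N], so [1 - u] is supported in
    [closure N]. *)
Lemma urysohn_compact (R : realType) (X : topologicalType) (x0 : X) (W : set X) :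
  locally_compact [set: X] -> hausdorff_space X -> open W -> W x0 ->
  exists (h : X -> R) (K : set X), [/\ continuous h, h x0 = 1,
    compact K /\ closed K, K `<=` W & forall x, h x != 0 -> K x].
Proof.
move=> lc hX oW Wx0.
have cr := @locally_compact_completely_regular X R lc hX.
have rg := completely_regular_regular cr.
have [V + [cV clV]] := lc x0 I.
rewrite withinET => Vx0.
have [N Nx0 clN] : filter_from (nbhs x0) closure (V `&` W).
  by apply: (rg R x0); apply: (@filterI _ (nbhs x0)) => //; exact: open_nbhs_nbhs.
have sep : uniform_separator [set x0] (~` N°).
  apply: cr; first exact/open_closedC/open_interior.
  by move=> /(_ (nbhs_singleton (nbhs_interior Nx0))).
pose u := @Urysohn X R [set x0] (~` N°).
exists (fun x => 1 - u x), (closure N); split.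
- move=> x; apply: cvgB; first exact: cvg_cst.
  exact: Urysohn_continuous.
- have u0 : [set 0] (u x0).
    by apply: (Urysohn_sub0 (R := R) sep); exists x0.
  by rewrite u0 subr0.
- split; last exact: closed_closure.
  by apply: (subclosed_compact _ cV); [exact: closed_closure
                                      |move=> y /clN []].
- by move=> y /clN [].
- move=> x; apply: contra_neqP => nx; apply/eqP; rewrite subr_eq0 eq_sym.
  apply/eqP; apply: (Urysohn_sub1 (R := R) sep); exists x => // /interior_subset Nx.
  by apply: nx; exact: subset_closure.
Qed.

(** * Two functions with the same action on l2(units) *)

Section IsotropyWitness.
Context (R : realType) (G : topologicalType) (Gd : groupoid G).
Hypothesis etG : etale_groupoid Gd.
Local Notation C := (R[i]^o).

Lemma units_sub_Iso : units Gd `<=` (Iso Gd)°.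
Proof.
move=> a ua; apply: (filterS _ (open_nbhs_nbhs (conj (units_open etG) ua))).
move=> b ub; rewrite /Iso /= -((unitsP Gd b).1 ub) src_unit rng_unit.
by [].
Qed.

Lemma subspace_hausdorff_src (B : set G) :
  (forall b c, B b -> B c -> src Gd b = src Gd c -> b = c) ->
  hausdorff_space B.
Proof.
have [_ _ hU _] := etG; move=> sB p q pq; apply: val_inj.
apply: sB; [exact: set_valP|exact: set_valP|].
apply: hU => M N Mp Nq.
have cs : continuous (fun x : B => src Gd (\val x)).
  move=> x; apply: continuous_comp; last exact: src_continuous.
  exact: initial_continuous.
have [x [Mx Nx]] := pq _ _ (cs p _ Mp) (cs q _ Nq).
by exists (src Gd (\val x)).
Qed.

Lemma isotropy_witness : ~ effective Gd ->
  exists (f f' : G -> C) (a : G), [/\ elementary f, elementary f',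
    f a - f' a != 0 &
    forall xi, act_sum (unit_action Gd) f xi = act_sum (unit_action Gd) f' xi].
Proof.
move=> neff.
have [a [Isoa nua]] : exists a, (Iso Gd)° a /\ ~ units Gd a.
  apply: contrapT => nex; apply: neff; apply/seteqP; split.
    exact: units_sub_Iso.
  by move=> a ia; apply: contrapT => nu; apply: nex; exists a.
have [U [oU Ua osU sU [g [gK cg]]]] := etale_chart etG a.
have [_ lcU hU _] := etG.
pose B := U `&` (Iso Gd)°.
have oB : open B by apply: openI => //; exact: open_interior.
have sB b c : B b -> B c -> src Gd b = src Gd c -> b = c.
  by move=> [Ub _] [Uc _]; exact: sU.
(* This is [src] of [B], written through the section [g] so that continuity of [g] makes it open. *)
pose W := src Gd @` U `&` g @^-1` B.
have oW : open W.
  have cg' : {in src Gd @` U, continuous g}.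
    by move: cg; rewrite continuous_open_subspace.
  by move/continuous_inP : cg' => /(_ osU B oB).
have Wa : W (src Gd a) by split; [exists a|rewrite /= gK].
have [h [K [ch ha [cK clK] KW hK]]] := urysohn_compact R lcU hU oW Wa.
pose f : G -> C := fun b => if b \in B then (h (src Gd b))%:C%C else 0.
pose f' : G -> C := fun b =>
  if b \in units Gd then (h (src Gd b))%:C%C else 0.
exists f, f', a; split.
- exists B; split=> //; first exact: subspace_hausdorff_src.
  apply: (@Cc_pullback _ _ _ etG B K h g) => //.
  + by apply: continuous_subspaceW cg => x /KW [].
  + by move=> x /KW [].
  + by move=> b [Ub _]; exact: gK.
  + by move=> b nB; rewrite /f ifF //; apply/negP => /set_mem.
  + by move=> b Bb; rewrite /f mem_set.
- exists (units Gd); split=> //; first exact: units_open.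
  apply: (@Cc_pullback _ _ _ etG (units Gd) K h (fun x => \val x)) => //.
  + exact: units_open.
  + by apply: continuous_subspaceT; exact: val_units_continuous.
  + by move=> x _; exact: set_valP.
  + by move=> b /unitsP.
  + by move=> b nB; rewrite /f' ifF //; apply/negP => /set_mem.
  + by move=> b Bb; rewrite /f' mem_set.
- rewrite /f /f' mem_set; last by split.
  rewrite ifF; last by apply/negP => /set_mem.
  by rewrite ha subr0 eq_complex /= oner_eq0.
- move=> xi; apply/funext => z.
  (* Both functions act as multiplication by [h]: an arrow of either support that ends at [z] also
     starts at [z], and each support has at most one such arrow. *)
  transitivity ((h z)%:C%C * xi z); last first.
    rewrite [RHS](@fsum_single _ _ _ _ (\val z)) /=.
    + by rewrite /f' mem_set ?src_unit //; exact: set_valP.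
    + by rewrite rng_unit.
    + move=> b bz nb; rewrite /f'; case: ifPn => [/set_mem ub|]; last first.
        by rewrite mul0r.
      exfalso; apply: nb.
      have ib : src Gd b = rng Gd b := interior_subset (units_sub_Iso ub).
      by rewrite -bz -ib ((unitsP Gd b).1 ub).
  have [Wz|nWz] := pselect (W z).
    have [[b Ub bz] Bz] := Wz.
    have gz : g z = b by rewrite -bz gK.
    move: Bz; rewrite /= gz => Bb.
    have isob : src Gd b = rng Gd b by have [_ /interior_subset] := Bb.
    rewrite [RHS](_ : _ = f b * xi (src Gd b)); last by rewrite /f mem_set // bz.
    apply: (@fsum_single _ _ _ _ b) => [|c /= cz cb].
      by rewrite /= -isob.
    rewrite /f; case: ifPn => [/set_mem Bc|]; last by rewrite mul0r.
    exfalso; apply: cb; apply: sB => //.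
    have [_ /interior_subset isoc] := Bc.
    by rewrite bz [LHS]isoc.
  (* Off [W] no arrow of [B] ends at [z], and [h] vanishes there too. *)
  rewrite (_ : h z = 0) ?mul0r; last first.
    by apply/eqP; apply: contra_notT nWz => /hK /KW.
  apply: fsbig1 => c /= cz; rewrite /f; case: ifPn => [/set_mem Bc|]; last first.
    by rewrite mul0r.
  exfalso; apply: nWz; have [Uc /interior_subset isoc] := Bc.
  have <- : src Gd c = z by rewrite [LHS]isoc.
  by split; [exists c|rewrite /= gK].
Qed.

End IsotropyWitness.

(** * Functions supported on the unit space *)

Section UnitFunctions.
Context (R : realType) (G : topologicalType) (Gd : groupoid G).
Local Notation C := (R[i]^o).
Implicit Types (k : G -> C) (U : set G).

(** Functional calculus on [Cc U]; [phi 0 = 0] prevents the support from growing. *)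
Lemma Cc_comp U k (phi : C -> C) : Cc U k -> continuous phi -> phi 0 = 0 ->
  Cc U (phi \o k).
Proof.
move=> [k0 ck cK] cphi phi0; split.
- by move=> a /k0 /= ->.
- by apply: within_continuous_comp ck => z _; exact: cphi.
- rewrite (_ : U `&` _ = (U `&` closure [set a | k a != 0]) `&`
      closure [set a | (phi \o k) a != 0]).
    by apply: compact_closedI => //; exact: closed_closure.
  apply/seteqP; split=> [a [Ua ca]|a [[]]//]; split=> //; split=> //.
  move: a ca {Ua}; apply: closureS => a /=.
  by apply: contra => /eqP ->; rewrite phi0.
Qed.

Lemma elementary_conv_algebra k : elementary k -> conv_algebra k.
Proof.
move=> ek; exists [:: (1, k)]; rewrite big_seq1 scale1r; split=> // p.
by rewrite inE => /eqP ->.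
Qed.

Hypothesis etG : etale_groupoid Gd.

Lemma Cc_units_conv_algebra k : Cc (units Gd) k -> conv_algebra k.
Proof.
move=> kC; have [_ _ hU _] := etG; apply: elementary_conv_algebra.
by exists (units Gd); split=> //; exact: units_open.
Qed.

Lemma conv_units k1 k2 : (forall a, ~ units Gd a -> k1 a = 0) ->
  (forall a, ~ units Gd a -> k2 a = 0) ->
  conv Gd k1 k2 = (fun a => k1 a * k2 a).
Proof.
move=> h1 h2; apply/funext => a.
rewrite /conv (@fsum_single _ _ _ _ (\val (src Gd a))).
- rewrite ginv_unit gmul_unitr.
  have [ua|/h1 ->] := pselect (units Gd a); last by rewrite !mul0r.
  by rewrite ((unitsP Gd a).1 ua).
- by rewrite /= src_unit.
- move=> b /= ba nb; rewrite (h2 b) ?mulr0 // => /unitsP ub.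
  by apply: nb; rewrite -ba ub.
Qed.

Lemma star_units k : (forall a, ~ units Gd a -> k a = 0) ->
  star Gd k = (fun a => Num.conj (k a)).
Proof.
move=> k0; apply/funext => a; rewrite /star; congr Num.conj.
have uinv b : units Gd b -> ginv Gd b = b.
  by move=> /unitsP ub; rewrite -{1}ub ginv_unit ub.
have [/uinv -> //|na] := pselect (units Gd a).
rewrite (k0 a) // k0 // => ua; apply: na.
by rewrite -[a](ginvK Gd) uinv.
Qed.

Section Bound.
Context (H : hilbert R) (rho : (G -> C) -> H -> H).
Hypothesis rhoR : star_representation Gd rho.

Lemma rep0 x : rho 0 x = 0.
Proof.
have [_ rhol _ _] := rhoR.
have := rhol 1 0 0 x (@conv_algebra0 R G) (@conv_algebra0 R G).
by rewrite !scale1r addr0 -[LHS]addr0 => /addrI <-.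
Qed.

Lemma repD f g x : conv_algebra f -> conv_algebra g ->
  rho (f + g) x = rho f x + rho g x.
Proof.
have [_ rhol _ _] := rhoR => hf hg.
by have := rhol 1 f g x hf hg; rewrite !scale1r.
Qed.

Lemma repZ c f x : conv_algebra f -> rho (c *: f) x = c *: rho f x.
Proof.
have [_ rhol _ _] := rhoR => hf.
by have := rhol c f 0 x hf (@conv_algebra0 R G); rewrite !addr0 rep0 addr0.
Qed.

Lemma rep_hnorm_sqr k x : Cc (units Gd) k -> Cc (units Gd) (star Gd k) ->
  ((hnorm (rho k x)) ^+ 2)%:C%C = hdot H (rho (conv Gd (star Gd k) k) x) x.
Proof.
have [_ _ rhom rhos] := rhoR.
move=> /Cc_units_conv_algebra kA /Cc_units_conv_algebra skA.
by rewrite -hdotxx rhom // rhos.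
Qed.

(* Elementary replacement for the spectral radius argument: [p = |k|^2 <= M]
   satisfies [M p = p^2 + g^2] with [g = sqrt (p (M - p))] in [Cc (units Gd)],
   so that [|rho p x|^2 <= M <rho p x, x>]. *)
Lemma rep_Cc_units_le k (c : R) x : Cc (units Gd) k -> 0 <= c ->
  (forall a, sqnorm (k a) <= c ^+ 2) -> hnorm (rho k x) <= c * hnorm x.
Proof.
move=> kC c0 kc; have [k0 _ _] := kC.
pose M := c ^+ 2.
pose ps (z : C) : C := (sqnorm z)%:C%C.
(* [Num.sqrt] is [0] on negative numbers, so [ts] is continuous even where [sqnorm z > M]; on the
   values of [k] the radicand is nonnegative. *)
pose ts (z : C) : R := Num.sqrt (sqnorm z * (M - sqnorm z)).
have cps : continuous ps.
  by move=> z; apply: (continuous_comp (@sqnorm_continuous R z));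
    exact: realC_continuous.
have cts : continuous ts.
  move=> z; apply: (@continuous_comp _ _ _ (fun z : C => sqnorm z * (M - sqnorm z))).
    have F := @nbhs_filter C z; have sz := @sqnorm_continuous R z.
    exact: (cvgM sz (cvgB (cvg_cst M) sz)).
  exact: sqrt_continuous.
have cgs : continuous (fun z => (ts z)%:C%C : C).
  by move=> z; apply: (continuous_comp (cts z)); exact: realC_continuous.
pose p := ps \o k; pose g := (fun z => (ts z)%:C%C : C) \o k.
have pC : Cc (units Gd) p by apply: Cc_comp => //; rewrite /ps sqnorm0.
have gC : Cc (units Gd) g.
  by apply: Cc_comp => //; rewrite /ts sqnorm0 mul0r sqrtr0.
have starE (q : G -> C) : Cc (units Gd) q -> star Gd q = (fun z => Num.conj z) \o q.
  by move=> [q0 _ _]; exact: star_units.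
have sC (q : G -> C) : Cc (units Gd) q -> Cc (units Gd) (star Gd q).
  move=> qC; rewrite starE //; apply: Cc_comp => //; last exact: rmorph0.
  exact: conjC_continuous.
have convE (q : G -> C) : Cc (units Gd) q ->
    conv Gd (star Gd q) q = (fun a => (sqnorm (q a))%:C%C).
  move=> qC; have [q0 _ _] := qC; have [sq0 _ _] := sC q qC.
  rewrite conv_units //; apply/funext => a; rewrite starE //=.
  case: (q a) => u v; apply/eqP; rewrite eq_complex /sqnorm /=.
  by apply/andP; split; apply/eqP; ring.
have kE := rep_hnorm_sqr x kC (sC k kC).
have pE := rep_hnorm_sqr x pC (sC p pC).
have gE := rep_hnorm_sqr x gC (sC g gC).
have kp : conv Gd (star Gd k) k = p by exact: convE.
pose q := conv Gd (star Gd p) p; pose r := conv Gd (star Gd g) g.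
have qC : Cc (units Gd) q.
  have -> : q = ps \o p by exact: convE.
  by apply: Cc_comp => //; rewrite /ps sqnorm0.
have rC : Cc (units Gd) r.
  have -> : r = ps \o g by exact: convE.
  by apply: Cc_comp => //; rewrite /ps sqnorm0.
have decomp : M%:C%C *: p = q + r.
  apply/funext => a; rewrite -[RHS]/(q a + r a) /q /r !convE //.
  rewrite -[LHS]/(M%:C%C * p a) /p /g /ps /= !sqnorm_real -rmorphM -rmorphD /=.
  congr (_%:C%C); rewrite /ts sqr_sqrtr; first by ring.
  by rewrite mulr_ge0 ?sqnorm_ge0 // subr_ge0 kc.
have pA := Cc_units_conv_algebra pC; have qA := Cc_units_conv_algebra qC.
have rA := Cc_units_conv_algebra rC.
(* Pair [M p = q + r] with [x]; as [q] and [r] are [p] and [g] convolved with their adjoints, they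
   contribute squared norms. *)
have key : M * complex.Re (hdot H (rho p x) x) =
    hnorm (rho p x) ^+ 2 + hnorm (rho g x) ^+ 2.
  have := congr1 (fun f => hdot H (rho f x) x) decomp.
  rewrite /= repZ // repD // linearDl linearZl_LR /= -/q -/r.
  rewrite -[hdot H (rho q x) x]pE -[hdot H (rho r x) x]gE => /(congr1 (@complex.Re R)).
  by case: (hdot H (rho p x) x) => a b /=; rewrite mul0r subr0.
have hx := hnorm_ge0 x; have hp := hnorm_ge0 (rho p x).
have M0 : 0 <= M by rewrite sqr_ge0.
have le1 := Re_hdot_le (rho p x) x.
have pM : hnorm (rho p x) <= M * hnorm x.
  have [->|pn0] := eqVneq (hnorm (rho p x)) 0; first by rewrite mulr_ge0.
  have pp : 0 < hnorm (rho p x) by rewrite lt_def pn0.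
  rewrite -(ler_pM2l pp) -expr2.
  apply: (@le_trans _ _ (M * complex.Re (hdot H (rho p x) x))).
    by rewrite key lerDl sqr_ge0.
  by rewrite [leRHS]mulrCA ler_wpM2l.
rewrite -(ler_pXn2r (_ : 0 < 2)%N) ?nnegrE ?mulr_ge0 ?hnorm_ge0 //.
(* What remains is Cauchy-Schwarz: [<rho p x, x> <= |rho p x| |x| <= M |x|^2], and [M = c ^+ 2]. *)
have -> : hnorm (rho k x) ^+ 2 = complex.Re (hdot H (rho p x) x).
  by rewrite -kp -kE.
apply: le_trans le1 _; rewrite exprMn [X in _ <= _ * X]expr2 mulrA.
by rewrite ler_wpM2r.
Qed.

Lemma rep_le_unorm f (e : R) x : conv_algebra f ->
  (unorm Gd f <= e%:E)%E -> hnorm (rho f x) <= e * hnorm x.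
Proof.
have [rhob _ _ _] := rhoR; move=> fA fe.
have [lin _] := rhob f fA.
have f0 : rho f 0 = 0.
  by have := lin 1 0 0; rewrite !scale1r addr0 -[LHS]addr0 => /addrI <-.
have linZ (c : R[i]) y : rho f (c *: y) = c *: rho f y.
  by have := lin c y 0; rewrite f0 !addr0.
have [x0|x0] := eqVneq (hnorm x) 0.
  have /eqP -> : x == 0 by rewrite -hnorm_eq0 x0.
  by rewrite f0 hnorm0 mulr0.
have hx : 0 < hnorm x by rewrite lt_def x0 hnorm_ge0.
have normZ (y : H) :
    hnorm (((hnorm x)^-1)%:C%C *: y) = (hnorm x)^-1 * hnorm y.
  rewrite hnorm_scale normc_def /= expr0n addr0 sqrtr_sqr ger0_norm //.
  by rewrite invr_ge0 ltW.
have : ((hnorm (rho f (((hnorm x)^-1)%:C%C *: x)))%:E <= e%:E)%E.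
  apply: le_trans fe; apply: (@le_trans _ _ (opnorm (rho f))).
    apply: ereal_sup_ubound; exists (((hnorm x)^-1)%:C%C *: x) => //=.
    by rewrite normZ mulVf.
  by apply: ereal_sup_ubound; exists H, rho.
by rewrite linZ normZ lee_fin ler_pdivrMl // mulrC.
Qed.

End Bound.

Lemma unorm_Cc_units_le k (c : R) : Cc (units Gd) k -> 0 <= c ->
  (forall a, sqnorm (k a) <= c ^+ 2) -> (unorm Gd k <= c%:E)%E.
Proof.
move=> kC c0 kc; apply: ge_ereal_sup => _ [H [rho [rhoR ->]]].
apply: ge_ereal_sup => _ [x x1 <-]; rewrite lee_fin.
apply: le_trans (rep_Cc_units_le rhoR x kC c0 kc) _.
by rewrite ler_piMr.
Qed.

End UnitFunctions.

(** * The kernel of a representation in the completion *)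

Section CstarSequences.
Context (R : realType) (G : topologicalType) (Gd : groupoid G).
Local Notation C := (R[i]^o).
Implicit Types (f g : G -> C) (u v : nat -> G -> C).

Lemma cauchy_repr (a : Cstar R Gd) : cauchy Gd (Cstar_repr a).
Proof. exact/asboolP/(valP (repr a)). Qed.

Lemma null_repr_pi (u : cauchy_seq R Gd) :
  null Gd (fun n => Cstar_repr (\pi_(Cstar R Gd) u) n - \val u n).
Proof.
have : repr (\pi_(Cstar R Gd) u) - u \in @null_pred R G Gd.
  by rewrite Quotient.idealrBE reprK.
move=> /asboolP h.
have -> : (fun n => Cstar_repr (\pi_(Cstar R Gd) u) n - \val u n) =
    \val (repr (\pi_(Cstar R Gd) u) - u) by rewrite linearB.
exact: h.
Qed.

Lemma pi_eq0 (u : cauchy_seq R Gd) :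
  (\pi_(Cstar R Gd) u = 0) <-> null Gd (\val u).
Proof.
have pi0 : \pi_(Cstar R Gd) (0 : cauchy_seq R Gd) = 0.
  apply: (@addrI _ (\pi_(Cstar R Gd) (0 : cauchy_seq R Gd))).
  by rewrite -pi_class_add !addr0.
rewrite -pi0; split=> [h|h].
  have : u - 0 \in @null_pred R G Gd by rewrite Quotient.idealrBE h.
  by rewrite subr0 => /asboolP.
by apply/eqP; rewrite -Quotient.idealrBE subr0; exact/asboolP.
Qed.

(** The supremum is over a nonempty family: the zero representation on l2(G) contributes [0]. *)
Lemma unorm_ge0 f : (0 <= unorm Gd f)%E.
Proof.
pose H := l2_hilbert R G; pose rho (_ : G -> C) (_ : H) : H := 0.
have rhoR : star_representation Gd rho.
  split=> // [h _|c h k x _ _|h x y _].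
  - split=> [c x y|]; first by rewrite scaler0 addr0.
    by exists 0 => x; rewrite hnorm0 mul0r.
  - by rewrite scaler0 addr0.
  - by rewrite linear0l linear0r.
apply: (@le_trans _ _ (opnorm (rho f))).
  by apply: ereal_sup_ubound; exists 0; rewrite /= hnorm0 ?ler01.
by apply: ereal_sup_ubound; exists H, rho.
Qed.

Lemma conv_algebraD f g :
  conv_algebra f -> conv_algebra g -> conv_algebra (f + g).
Proof. by move=> fA gA; rewrite -[f]scale1r; exact: conv_algebraP. Qed.

Lemma unorm_sub_le f g : conv_algebra f -> conv_algebra g ->
  (unorm Gd f <= unorm Gd (f - g)%R + unorm Gd g)%E.
Proof.
move=> fA gA; have := unorm_scale_add Gd 1 (conv_algebraB fA gA) gA.
by rewrite scale1r subrK normr1 mul1e.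
Qed.

(* The finiteness of [unorm] is not needed for the limit to exist: along a Cauchy
   sequence [unorm] is either eventually [+oo] or eventually real and Cauchy. *)
Lemma Cstar_norm_lt (a : Cstar R Gd) (e : R) : (Cstar_norm a < e%:E)%E ->
  exists N, forall n, (N <= n)%N -> (unorm Gd (Cstar_repr a n) < e%:E)%E.
Proof.
have [aA aC] := cauchy_repr a.
pose v n := unorm Gd (Cstar_repr a n).
have vC (d : R) : 0 < d -> exists N, forall m n, (N <= m)%N -> (N <= n)%N ->
    (v m <= d%:E + v n)%E.
  move=> d0; have [N hN] := aC d d0; exists N => m n Nm Nn.
  apply: le_trans (unorm_sub_le (aA m) (aA n)) _.
  by apply: leeD => //; exact: ltW (hN m n Nm Nn).
rewrite /Cstar_norm -/v.
have [N hN] := vC 1 ltr01.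
have [vN|vN] := eqVneq (v N) +oo%E.
  have vcst n : (N <= n)%N -> v n = +oo%E.
    move=> Nn; apply/eqP; rewrite -leye_eq.
    have := hN N n (leqnn N) Nn; rewrite vN.
    by case: (v n) => [r| |].
  rewrite (_ : limn v = +oo%E) //; apply: cvg_lim => //.
  apply: cvg_near_cst; exists N => // n /= Nn; exact: vcst.
have vfin n : (N <= n)%N -> v n \is a fin_num.
  move=> Nn; rewrite ge0_fin_numE ?unorm_ge0 //.
  apply: le_lt_trans (hN n N Nn (leqnn N)) _.
  by rewrite lte_add_pinfty ?ltry // lt_neqAle vN leey.
pose r n := fine (v n).
have rE n : (N <= n)%N -> v n = (r n)%:E by move=> /vfin /fineK.
have rC : cvgn r.
  apply: cauchy_real_cvgn => d d0.
  have [N' hN'] := vC (d / 2) (divr_gt0 d0 (ltr0Sn _ 1)).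
  exists (maxn N N') => m n; rewrite !geq_max => /andP[m1 m2] /andP[n1 n2].
  have := hN' m n m2 n2; have := hN' n m n2 m2.
  rewrite !rE // -!EFinD !lee_fin => h1 h2.
  apply: (@le_lt_trans _ _ (d / 2)); last first.
    by rewrite ltr_pdivrMr // ltr_pMr // ltr1n.
  by rewrite ler_norml; apply/andP; split; lra.
have vr : v @ \oo --> (limn r)%:E.
  apply: (@cvg_trans _ ((fun n => (r n)%:E) @ \oo)).
    apply: near_eq_cvg; exists N => // n /= Nn; exact: esym (rE n Nn).
  exact: cvg_comp rC _.
rewrite (cvg_lim _ vr) // lte_fin => lr.
have [N' _ hN'] := cvgr_lt _ rC _ lr.
exists (maxn N N') => n; rewrite geq_max => /andP[n1 n2].
by rewrite -/(v n) rE // lte_fin; exact: hN'.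
Qed.

End CstarSequences.

Section KernelIdeal.
Context (R : realType) (G : topologicalType) (Gd : groupoid G).
Local Notation C := (R[i]^o).
Context (H : hilbert R) (rho : (G -> C) -> H -> H).
Hypothesis rhoR : star_representation Gd rho.
Implicit Types (f g : G -> C) (u v : nat -> G -> C) (e : R).

Definition rep_small e u : Prop := exists N, forall n, (N <= n)%N ->
  forall x, hnorm (rho (u n) x) <= e * hnorm x.

Definition rep_null u : Prop := forall e, 0 < e -> rep_small e u.

(** The kernel of the continuous extension of [rho]: the operators of a representing sequence tend
    to [0] in norm. *)
Definition rep_kernel : set (Cstar R Gd) :=
  [set a | rep_null (Cstar_repr a)].

Lemma rep_small_null e e' u v : (forall n, conv_algebra (u n)) ->
  (forall n, conv_algebra (v n)) -> rep_small e u ->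
  null Gd (fun n => v n - u n) -> 0 < e' -> rep_small (e + e') v.
Proof.
move=> uA vA [N hN] vu e0; have [N' hN'] := vu e' e0.
exists (maxn N N') => n; rewrite geq_max => /andP[n1 n2] x.
rewrite -[v n](subrK (u n)) (repD rhoR) //; last exact: conv_algebraB.
apply: le_trans (hnorm_add _ _) _; rewrite addrC mulrDl lerD ?hN //.
apply: (rep_le_unorm rhoR); first exact: conv_algebraB.
exact: ltW (hN' n n2).
Qed.

Lemma null_opp u v : (forall n, conv_algebra (u n)) ->
  (forall n, conv_algebra (v n)) ->
  null Gd (fun n => u n - v n) -> null Gd (fun n => v n - u n).
Proof.
move=> uA vA uv e e0; have [N hN] := uv e e0; exists N => n Nn.
apply: le_lt_trans (hN n Nn).
have := unorm_scale_add Gd (-1) (conv_algebraB (uA n) (vA n)) (@conv_algebra0 R G).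
rewrite scaleN1r addr0 opprB normrN1 mul1e => /le_trans; apply.
by rewrite -[leRHS]adde0 leeD // unorm0.
Qed.

Lemma rep_null_eq u v : (forall n, conv_algebra (u n)) ->
  (forall n, conv_algebra (v n)) -> rep_null u ->
  null Gd (fun n => v n - u n) -> rep_null v.
Proof.
move=> uA vA uN vu e e0; rewrite (splitr e).
by apply: (@rep_small_null _ _ u) => //; [apply: uN|]; rewrite divr_gt0.
Qed.

Lemma rep_kernel_pi (u : cauchy_seq R Gd) :
  rep_kernel (\pi_(Cstar R Gd) u) <-> rep_null (\val u).
Proof.
have [rA _] := cauchy_repr (\pi_(Cstar R Gd) u).
have /asboolP[uA _] := valP u.
have h := null_repr_pi u; split=> [k|k].
  by apply: (rep_null_eq rA uA k); exact: null_opp.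
exact: rep_null_eq uA rA k h.
Qed.

Lemma rep_small_add e e' u v : (forall n, conv_algebra (u n)) ->
  (forall n, conv_algebra (v n)) -> rep_small e u -> rep_small e' v ->
  rep_small (e + e') (fun n => u n + v n).
Proof.
move=> uA vA [N hN] [N' hN']; exists (maxn N N') => n.
rewrite geq_max => /andP[n1 n2] x; rewrite (repD rhoR) //.
by apply: le_trans (hnorm_add _ _) _; rewrite mulrDl lerD ?hN ?hN'.
Qed.

Lemma rep_cauchy_bound u : cauchy Gd u ->
  exists K, 0 < K /\ rep_small K u.
Proof.
move=> [uA uC]; have [N hN] := uC 1 ltr01.
have [rhob _ _ _] := rhoR; have [_ [M hM]] := rhob _ (uA N).
(* [M] bounds [rho (u N)], and later terms are within [1] of [u N] in [unorm]. *)
exists (`|M| + 1); split; first by rewrite ltr_wpDl.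
exists N => n Nn x; rewrite -[u n](subrK (u N)) (repD rhoR) //; last first.
  exact: conv_algebraB.
apply: le_trans (hnorm_add _ _) _; rewrite addrC mulrDl lerD //.
  by apply: le_trans (hM x) _; rewrite ler_wpM2r ?hnorm_ge0 // ler_norm.
apply: (rep_le_unorm rhoR); first exact: conv_algebraB.
exact: ltW (hN n N Nn (leqnn N)).
Qed.

Lemma rep_kernel_mul (a b : Cstar R Gd) : rep_kernel a \/ rep_kernel b ->
  rep_kernel (Cstar_mul a b).
Proof.
move=> ab; have [_ _ rhom _] := rhoR.
have [aA _] := cauchy_repr a; have [bA _] := cauchy_repr b.
rewrite /Cstar_mul /Cstar_class; apply/rep_kernel_pi.
(* [Cstar_class] sends a sequence that is not Cauchy to the class of [0]. For a Cauchy product, one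
   factor decays while the other is eventually bounded. *)
rewrite val_insubd; case: ifP => _ e e0; last first.
  exists 0%N => n _ x; rewrite (_ : \val 0 n = 0) // (rep0 rhoR) hnorm0.
  by rewrite mulr_ge0 ?hnorm_ge0 // ltW.
have [Ka [Ka0 [Na ha]]] := rep_cauchy_bound (cauchy_repr a).
have [Kb [Kb0 [Nb hb]]] := rep_cauchy_bound (cauchy_repr b).
case: ab => [/(_ (e / Kb) (divr_gt0 e0 Kb0))|/(_ (e / Ka) (divr_gt0 e0 Ka0))].
  move=> [N hN]; exists (maxn N Nb) => n; rewrite geq_max => /andP[n1 n2] x.
  rewrite rhom //; apply: le_trans (hN n n1 _) _.
  apply: (@le_trans _ _ (e / Kb * (Kb * hnorm x))).
    by rewrite ler_wpM2l ?hb // ltW // divr_gt0.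
  by rewrite mulrA divfK // gt_eqF.
move=> [N hN]; exists (maxn N Na) => n; rewrite geq_max => /andP[n1 n2] x.
rewrite rhom //; apply: le_trans (ha n n2 _) _.
apply: (@le_trans _ _ (Ka * (e / Ka * hnorm x))).
  by rewrite ler_wpM2l ?hN // ltW.
by rewrite mulrA mulrCA mulfV ?mulr1 // gt_eqF.
Qed.

Lemma rep_kernel_ideal : closed_ideal rep_kernel.
Proof.
have reprA (a : Cstar R Gd) := (cauchy_repr a).1.
split.
- have -> : (0 : Cstar R Gd) = \pi_(Cstar R Gd) (0 : cauchy_seq R Gd).
    by apply/esym/pi_eq0 => e e0; exists 0%N => n _;
      apply: le_lt_trans (unorm0 R Gd) _; rewrite lte_fin.
  apply/rep_kernel_pi => e e0; exists 0%N => n _ x.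
  rewrite (_ : \val 0 n = 0) // (rep0 rhoR) hnorm0.
  by rewrite mulr_ge0 ?hnorm_ge0 // ltW.
- move=> a b aK bK; rewrite -[a]reprK -[b]reprK -pi_class_add.
  apply/rep_kernel_pi => e e0; rewrite (splitr e).
  by apply: rep_small_add; [exact: reprA|exact: reprA|apply: aK|apply: bK];
    rewrite divr_gt0.
- move=> c a aK; rewrite -[a]reprK [_ *: _]pi_scale; apply/rep_kernel_pi.
  move=> e e0; pose k := complex.Re `|c|.
  have k0 : 0 <= k by rewrite /k normc_def /= sqrtr_ge0.
  have [|N hN] := aK (e / (k + 1)); first by rewrite divr_gt0 // ltr_wpDl.
  exists N => n Nn x; rewrite [\val _ n](_ : _ = c *: Cstar_repr a n) //.
  rewrite (repZ rhoR) ?reprA // hnorm_scale -/k.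
  apply: (@le_trans _ _ (k * (e / (k + 1) * hnorm x))).
    by rewrite ler_wpM2l ?hN.
  rewrite mulrA ler_wpM2r ?hnorm_ge0 // mulrCA ler_piMr ?ltW //.
  by rewrite ltr_pdivrMr ?mul1r ?ltrDl // ltr_wpDl.
- by move=> a b bK; apply: rep_kernel_mul; right.
- by move=> a b aK; apply: rep_kernel_mul; left.
(* Write [a = (a - b) + b]: a quarter of [e] for each summand, and a half for passing to the
   representative of the sum. *)
- move=> a close e e0; have e4 : 0 < e / 2 / 2 by rewrite !divr_gt0.
  have [b bK /Cstar_norm_lt [N hN]] := close _ e4.
  have abE : a = \pi_(Cstar R Gd) (repr (a - b) + repr b).
    by rewrite pi_class_add !reprK subrK.
  have sm : rep_small (e / 2 / 2 + e / 2 / 2)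
      (fun n => Cstar_repr (a - b) n + Cstar_repr b n).
    apply: rep_small_add; [exact: reprA|exact: reprA| |exact: bK].
    exists N => n Nn x; apply: (rep_le_unorm rhoR); first exact: reprA.
    exact: ltW (hN n Nn).
  rewrite (splitr e) {1}(splitr (e / 2)).
  apply: (rep_small_null _ _ sm); last by rewrite divr_gt0.
  + by move=> n; apply: conv_algebraD; exact: reprA.
  + exact: reprA.
  + by have := null_repr_pi (repr (a - b) + repr b); rewrite -abE.
Qed.

End KernelIdeal.

Arguments rep_kernel {R G} Gd {H} rho.

(** * The unit space and left regular representations *)

Section PointMass.
Context (R : realType) (X : choiceType).
Local Notation C := (R[i]^o).

Definition point_mass (z : X) : X -> C := fun x => if x == z then 1 else 0.

Lemma point_mass_l2 z : point_mass z \in @l2_pred R X.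
Proof.
apply/asboolP; rewrite /rsummable.
rewrite (_ : (fun x => _) = fun x => if x \in [set z] then 1%E else 0%E).
  rewrite -esum_mkcond esum_set1 ?ltry //.
apply/funext => x; rewrite /point_mass.
have -> : (x \in [set z]) = (x == z).
  by apply/idP/eqP => [/set_mem //|->]; rewrite inE.
case: eqP => _.
  by rewrite /sqnorm /= expr1n expr0n addr0 normr1.
by rewrite sqnorm0 normr0.
Qed.

Definition l2_point_mass z : l2 R X := L2 (point_mass_l2 z).

Lemma small_coefficient (x : l2_hilbert R X) (e : R) z : 0 < e ->
  hnorm x <= e -> sqnorm (\val (x : l2 R X) z) <= e ^+ 2.
Proof.
move=> e0 xe; apply: le_trans (sqnorm_le_norm x z) _.
by rewrite ler_pXn2r ?nnegrE ?(ltW e0) ?sqrtr_ge0.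
Qed.

End PointMass.

(** Divides a tolerance by a norm [d] whose value is not computed; the [+ 1] guards against
    [d = 0]. *)
Lemma ler_div_succ_mul (R : realType) (r d : R) : 0 <= r -> 0 <= d ->
  r / (d + 1) * d <= r.
Proof.
move=> r0 d0; rewrite -mulrA ler_piMr // mulrC ler_pdivrMr ?mul1r ?lerDl //.
by rewrite ltr_wpDl.
Qed.

Section UnitRepresentation.
Context (R : realType) (G : topologicalType) (Gd : groupoid G).
Hypothesis etG : etale_groupoid Gd.
Local Notation C := (R[i]^o).

Let rho := act_op (R := R) (unit_action Gd).

Lemma unit_representation : star_representation Gd rho.
Proof.
apply: act_op_star_representation => f; exact: conv_algebra_bfin.
Qed.

Lemma left_representation :
  star_representation Gd (act_op (R := R) (left_action Gd)).
Proof.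
apply: act_op_star_representation => f; exact: conv_algebra_bfin.
Qed.

Lemma act_sum_unit_point_mass (k : G -> C) (x : units Gd) :
  (forall a, ~ units Gd a -> k a = 0) ->
  act_sum (unit_action Gd) k (point_mass R x) x = k (\val x).
Proof.
move=> k0; rewrite /act_sum (@fsum_single _ _ _ _ (\val x)) /=.
- by rewrite src_unit /point_mass eqxx mulr1.
- by rewrite rng_unit.
- move=> b bx nb; have [ub|/k0 ->] := pselect (units Gd b); last by rewrite mul0r.
  exfalso; apply: nb; rewrite -bx.
  have ib : src Gd b = rng Gd b := interior_subset (units_sub_Iso etG ub).
  by rewrite -ib ((unitsP Gd b).1 ub).
Qed.

(** Only [b = a] satisfies [gmul (ginv b) a = src a], so a matrix coefficient of the left regular
    representation recovers [k a]. *)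
Lemma act_sum_left_point_mass (k : G -> C) (a : G) :
  act_sum (left_action Gd) k (point_mass R (\val (src Gd a))) a = k a.
Proof.
rewrite /act_sum (@fsum_single _ _ _ _ a) //=.
  by rewrite gmulVl /point_mass eqxx mulr1.
move=> b ba nb; rewrite /point_mass ifF ?mulr0 //; apply/negP => /eqP e.
apply: nb; have := congr1 (gmul Gd b) e.
rewrite gmulA ?rng_ginv ?src_ginv // gmulV ba gmul_unitl => ->.
have sb : src Gd b = src Gd a.
  have := congr1 (rng Gd) e; rewrite rng_gmul ?src_ginv // rng_ginv => ->.
  by rewrite rng_unit.
by rewrite -sb gmul_unitr.
Qed.

Lemma rep_kernel_C0 : rep_kernel Gd rho `&` @Cstar_C0 R G Gd `<=` [set 0].
Proof.
move=> a [aK [h [h0 _ _] [u [uC uh aE]]]]; rewrite aE in aK *.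
have uN := (rep_kernel_pi unit_representation u).1 aK.
have u0 n b : ~ units Gd b -> \val u n b = 0.
  by have [k0 _ _] := uC n; exact: k0.
have hE : h = 0.
  apply/funext => b; have [ub|/h0 //] := pselect (units Gd b).
  pose x : units Gd := SigSub (mem_set ub).
  apply/eqP; apply: contraT => hb.
  have hb0 : 0 < `|h b| by rewrite normr_gt0.
  (* Were [r = |h b|] positive, uniform convergence would place [u n b] within less than [r / 2] of
     [h b], while decay on the point mass at [b] bounds [|u n b|] by [r / 2]. *)
  have [r0 rE] := complex_gt0 hb0; set r := complex.Re `|h b| in r0 rE.
  have [N hN] := uh (r / 2) (divr_gt0 r0 (ltr0Sn _ 1)).
  pose d := hnorm (l2_point_mass R x : l2_hilbert R _).
  have d0 : 0 <= d by exact: hnorm_ge0.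
  have [N' hN'] : rep_small rho (r / 2 / (d + 1)) (\val u).
    by apply: uN; rewrite !divr_gt0 // ltr_wpDl.
  pose n := maxn N N'.
  have r2 : 0 < r / 2 by rewrite divr_gt0.
  have := hN' n (leq_maxr _ _) (l2_point_mass R x); rewrite -/d => le1.
  have le2 : hnorm (rho (\val u n) (l2_point_mass R x)) <= r / 2.
    by apply: le_trans le1 _; rewrite ler_div_succ_mul // ltW.
  have uA : conv_algebra (\val u n) by exact: Cc_units_conv_algebra (uC n).
  have := small_coefficient x r2 le2.
  rewrite act_opE; last exact: conv_algebra_bfin.
  rewrite act_sum_unit_point_mass /=; last exact: u0.
  have := hN n (leq_maxl _ _) b; rewrite distrC normC_lt // => lt3 le3.
  have : `|h b| < `|h b|; last by rewrite ltxx.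
  have hbE : h b = (h b - \val u n b) + \val u n b by rewrite subrK.
  have nle : `|\val u n b| <= (r / 2)%:C%C.
    rewrite normC_sqnorm lecR -(ger0_norm (ltW r2)) -sqrtr_sqr.
    exact: ler_wsqrtr.
  rewrite {1}hbE; apply: le_lt_trans (ler_normD _ _) _.
  rewrite rE (splitr r) rmorphD; apply: ltr_leD => //.
  by rewrite normC_lt.
(* With [h = 0] the sequence tends to [0] uniformly, and [unorm] is dominated by the sup norm on
   [Cc (units Gd)]. *)
apply/pi_eq0 => e e0; have e2 : 0 < e / 2 by rewrite divr_gt0.
have [N hN] := uh _ e2; exists N => n Nn.
apply: (@le_lt_trans _ _ (e / 2)%:E); last first.
  by rewrite lte_fin ltr_pdivrMr // ltr_pMr // ltr1n.
apply: (unorm_Cc_units_le etG (uC n) (ltW e2)) => b.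
by have := hN n Nn b; rewrite hE subr0 normC_lt // => /ltW.
Qed.

(** [full_uniqueness_property] compares the intersection with [[set 0]] itself, so [0] has to be
    exhibited in it. *)
Lemma C0_rep_kernel0 : [set 0] `<=` rep_kernel Gd rho `&` @Cstar_C0 R G Gd.
Proof.
move=> _ ->; split.
  exact: (closed_ideal0 (rep_kernel_ideal unit_representation)).
have Cc0 : Cc (units Gd) (0 : G -> C).
  split=> //; first exact: cst_continuous.
  rewrite (_ : [set a | _] = set0) ?closure0 ?setI0; first exact: compact0.
  by apply/seteqP; split=> a //=; rewrite eqxx.
exists 0; first split=> //; first exact: cst_continuous.
  move=> e e0; rewrite (_ : [set x | _] = set0); first exact: compact0.
  apply/seteqP; split=> a //= -[_]; rewrite normr0 => h.
  by move: h; rewrite -[X in _ <= X]/(0%:C%C) lecR leNgt e0.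
exists 0; split.
- by move=> n.
- move=> e e0; exists 0%N => n _ x.
  by rewrite [X in `|X|](_ : _ = 0) ?normr0 ?ltcR // subrr.
- by apply/esym/pi_eq0 => e e0; exists 0%N => n _;
    apply: le_lt_trans (unorm0 R Gd) _; rewrite lte_fin.
Qed.

Lemma kernel_neq0 : ~ effective Gd -> rep_kernel Gd rho <> [set 0].
Proof.
move=> /(isotropy_witness R etG) [f [f' [a [ef ef' fa ff']]]].
have fA := elementary_conv_algebra ef; have f'A := elementary_conv_algebra ef'.
pose F : G -> C := f - f'.
have FA : conv_algebra F by exact: conv_algebraB.
have uC : (fun _ : nat => F) \in @cauchy_pred R G Gd.
  apply/asboolP; split=> // e e0; exists 0%N => m n _ _; rewrite subrr.
  by apply: le_lt_trans (unorm0 R Gd) _; rewrite lte_fin.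
pose u : cauchy_seq R Gd := CauchySeq uC.
move=> K0.
have : rep_kernel Gd rho (\pi_(Cstar R Gd) u).
  apply/(rep_kernel_pi unit_representation) => e e0; exists 0%N => n _ x /=.
  rewrite (_ : rho F x = 0).
    by rewrite hnorm0 mulr_ge0 ?hnorm_ge0 // ltW.
  have rD := repD unit_representation x f'A FA.
  have : rho f x = rho f' x.
    apply: (@val_inj _ _ (l2 R (units Gd))).
    by rewrite !act_opE ?ff' //; exact: conv_algebra_bfin.
  have -> : f = f' + F by rewrite addrC subrK.
  by rewrite rD -[RHS]addr0 => /addrI.
rewrite K0 => /pi_eq0 /= nF.
pose delta : l2_hilbert R G := l2_point_mass R (\val (src Gd a)).
have d0 : 0 <= hnorm delta by exact: hnorm_ge0.
have s0 : 0 < sqnorm (F a) by rewrite lt_def sqnorm_eq0 fa sqnorm_ge0.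
(* A constant null sequence makes [unorm F] arbitrarily small; this [e] would force the coefficient
   [F a] below half its own modulus. *)
pose e := Num.sqrt (sqnorm (F a)) / 2 / (hnorm delta + 1).
have r0 : 0 < Num.sqrt (sqnorm (F a)) / 2 by rewrite divr_gt0 // sqrtr_gt0.
have [|N hN] := nF e; first by rewrite divr_gt0 // ltr_wpDl.
have := rep_le_unorm left_representation delta FA (ltW (hN N (leqnn N))).
move=> le1; have /(small_coefficient a r0) :
    hnorm (act_op (left_action Gd) F delta) <= Num.sqrt (sqnorm (F a)) / 2.
  by apply: le_trans le1 _; rewrite ler_div_succ_mul // ltW.
rewrite act_opE; last exact: conv_algebra_bfin.
rewrite act_sum_left_point_mass exprMn sqr_sqrtr ?sqnorm_ge0 //.
by rewrite leNgt gtr_pMr // exprVn invf_lt1 ?exprn_gt0 // -natrX ltr1n.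
Qed.

End UnitRepresentation.

Theorem corollary3p2p5 (R : realType) (G : topologicalType) (Gd : groupoid G)
    (etG : etale_groupoid Gd) (fuG : full_uniqueness_property R Gd) :
  effective Gd.
Proof.
apply: contrapT => neff.
apply: (fuG _ (rep_kernel_ideal (unit_representation R etG))).
  exact: kernel_neq0.
by apply/seteqP; split; [exact: rep_kernel_C0|exact: C0_rep_kernel0].
Qed.
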